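(* Let $(X_0,X_1)$ be a compatible couple and let $a\in SV(0,\infty)\cap AC(0,\infty)$ satisfy $$a\ \text{is strictly decreasing},\quad a(0)=\infty,\quad a(\infty)>0.$$ Let $\alpha\in SV(0,\infty)\cap AC(0,\infty)$ be such that $$\alpha\ \text{is strictly decreasing},\quad \alpha(0)=\infty,\quad \alpha(\infty)=0,$$ assume that $A\in SV(0,\infty)$ is given by $$A(x):=a(x)\ \text{ if } x\in(0,1],\qquad A(x):=c\,\alpha(x)\ \text{ if } x\in(1,\infty),$$ where $c$ is a positive constant chosen in such a way that $A\in AC(0,\infty)$, and let $$B(x):=-x\,A'(x)\quad\text{for a.a. } x>0.$$ Then $$(X_0,X_1)_{0,1,a;J}=X_0\cap(X_0,X_1)_{0,1,A;J}=X_0\cap(X_0,X_1)_{0,1,B;K}.$$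
   Context: A pair $(X_0,X_1)$ of Banach spaces is a compatible couple if there is a Hausdorff topological vector space in which both $X_0$ and $X_1$ are continuously embedded. The intersection $X\cap Y$ of two Banach spaces embedded in a common space carries the norm $\max\{\|f\|_{X},\|f\|_{Y}\}$, and $X_0+X_1$ carries the norm $\inf\{\|f_0\|_{X_0}+\|f_1\|_{X_1}: f=f_0+f_1\}$. For $t>0$, $$K(f,t;X_0,X_1):=\inf\{\|f_0\|_{X_0}+t\|f_1\|_{X_1}: f=f_0+f_1,\ f_0\in X_0,\ f_1\in X_1\}\quad (f\in X_0+X_1),$$ $$J(f,t;X_0,X_1):=\max\{\|f\|_{X_0},t\|f\|_{X_1}\}\quad (f\in X_0\cap X_1).$$ $\|\cdot\|_{1,(c,d)}$ is the $L_1$-norm on $(c,d)$. For a weight $v$ on $(0,\infty)$ (non-negative, measurable, finite a.e.): - $(X_0,X_1)_{0,1,v;K}$ is the set of $f\in X_0+X_1$ with $\|f\|_{0,1,v;K}:=\|t^{-1}v(t)K(f,t;X_0,X_1)\|_{1,(0,\infty)}<\infty$. - $(X_0,X_1)_{0,1,v;J}$ is the set of $f\in X_0+X_1$ for which there is a strongly measurable $u:(0,\infty)\to X_0\cap X_1$ with $f=\int_0^\infty u(s)\,\frac{ds}{s}$ (convergence in $X_0+X_1$) and for which $\|f\|_{0,1,v;J}:=\inf\|t^{-1}v(t)J(u(t),t;X_0,X_1)\|_{1,(0,\infty)}$ is finite, the infimum being over all such representations of $f$. Equality of two spaces means that they are equal as sets and their norms are equivalent. $SV(0,\infty)$ is the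 set of slowly varying functions: positive, finite, Lebesgue-measurable functions $b$ on $(0,\infty)$ such that for each $\varepsilon>0$, $t^{\varepsilon}b(t)$ is equivalent to a non-decreasing function on $(0,\infty)$ and $t^{-\varepsilon}b(t)$ is equivalent to a non-increasing function on $(0,\infty)$ (two non-negative functions are equivalent if each is bounded by a positive constant multiple of the other). $AC(0,\infty)$ is the set of functions that are absolutely continuous on every compact subinterval of $(0,\infty)$. For monotone $f$ on $(0,\infty)$, $f(0):=\lim_{t\to0+}f(t)$ and $f(\infty):=\lim_{t\to\infty}f(t)$. *)

(* Defs.v *)
From HB Require Import structures.
From mathcomp Require Import all_boot all_order all_algebra.
From mathcomp Require Import all_classical all_reals all_analysis.

Set Implicit Arguments.
Unset Strict Implicit.
Unset Printing Implicit Defensive.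

Import Order.TTheory GRing.Theory Num.Theory.
Import numFieldTopology.Exports numFieldNormedType.Exports.

Local Open Scope classical_set_scope.
Local Open Scope ring_scope.

(** Functions on (0,oo) are represented by functions on R, of which only the
    restriction to (0,oo) is used. *)

Section functions_on_half_line.
Context {R : realType}.

Definition pos : set R := `]0, +oo[.

Definition equivalent (f g : R -> R) : Prop :=
  exists c1 c2 : R, [/\ 0 < c1, 0 < c2 &
    forall t, 0 < t -> f t <= c1 * g t /\ g t <= c2 * f t].

(* Lebesgue measurability is measurability for the Caratheodory sigma-algebra;
   the default sigma-algebra on R is the Borel one. *)
Definition lebesgue_measurable_fun (b : R -> R) : Prop :=
  @measurable_fun _ _ (caratheodory_type (wlength (idfun : R -> R))^*%mu) R
    pos b.

Definition slowly_varying (b : R -> R) : Prop :=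
  [/\ forall t, 0 < t -> 0 < b t,
      lebesgue_measurable_fun b &
      forall e : R, 0 < e ->
        (exists phi : R -> R,
          [/\ forall t, 0 < t -> 0 <= phi t,
              forall s t, 0 < s -> s <= t -> phi s <= phi t &
              equivalent (fun t => t `^ e * b t) phi]) /\
        (exists psi : R -> R,
          [/\ forall t, 0 < t -> 0 <= psi t,
              forall s t, 0 < s -> s <= t -> psi t <= psi s &
              equivalent (fun t => t `^ (- e) * b t) psi])].

Definition abs_continuous_on (x y : R) (f : R -> R) : Prop :=
  forall e : R, 0 < e -> exists2 d : R, 0 < d &
    forall (n : nat) (l r : 'I_n -> R),
      (forall i, [/\ x <= l i, l i <= r i & r i <= y]) ->
      trivIset setT (fun i => `]l i, r i[%classic) ->
      \sum_(i < n) (r i - l i) < d ->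
      \sum_(i < n) `|f (r i) - f (l i)| < e.

Definition locally_abs_continuous (f : R -> R) : Prop :=
  forall x y, 0 < x -> x <= y -> abs_continuous_on x y f.

Definition strictly_decreasing (f : R -> R) : Prop :=
  forall s t, 0 < s -> s < t -> f t < f s.

Definition L1norm (g : R -> \bar R) : \bar R :=
  (\int[lebesgue_measure]_(t in pos) `|g t|)%E.

End functions_on_half_line.

(** A space lying inside an ambient vector space [Z]: its underlying set
    together with its norm. Only the values of [enorm] on [carrier] matter. *)
Record normed_subspace (R : realType) (Z : Type) := NormedSubspace {
  carrier : set Z;
  enorm : Z -> \bar R }.

Definition same_space {R : realType} {Z : Type} (E F : normed_subspace R Z) : Prop :=
  carrier E = carrier F /\
  exists c1 c2 : R, [/\ 0 < c1, 0 < c2 &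
    forall f, carrier E f ->
      (enorm E f <= c1%:E * enorm F f)%E /\
      (enorm F f <= c2%:E * enorm E f)%E].

Section couples.
Context {R : realType} {Z : lmodType R}.
Implicit Types E F : normed_subspace R Z.

(* The copy i(X) of X in Z. When i is injective the infimum is over a single
   value on the carrier. *)
Definition embedded (X : normedModType R) (i : X -> Z) : normed_subspace R Z :=
  {| carrier := range i;
     enorm := fun z => ereal_inf [set `|x|%:E | x in i @^-1` [set z]] |}.

Definition inter_space E F : normed_subspace R Z :=
  {| carrier := carrier E `&` carrier F;
     enorm := fun z => maxe (enorm E z) (enorm F z) |}.

Definition decomp E F (f : Z) : set (Z * Z) :=
  [set p | [/\ carrier E p.1, carrier F p.2 & f = p.1 + p.2]].

Definition Kfun E F (f : Z) (t : R) : \bar R :=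
  ereal_inf [set (enorm E p.1 + t%:E * enorm F p.2)%E | p in decomp E F f].

Definition Jfun E F (f : Z) (t : R) : \bar R :=
  maxe (enorm E f) (t%:E * enorm F f)%E.

Definition sum_space E F : normed_subspace R Z :=
  {| carrier := [set f | decomp E F f !=set0];
     enorm := fun f =>
       ereal_inf [set (enorm E p.1 + enorm F p.2)%E | p in decomp E F f] |}.

(** Bochner integration over (0,oo) with respect to Lebesgue measure, of
    functions with values in [E]. *)

Definition simple_in E (s : R -> Z) : Prop :=
  [/\ forall t, 0 < t -> carrier E (s t),
      finite_set (s @` pos) &
      forall z, measurable (pos `&` s @^-1` [set z])].

Definition strongly_measurable E (u : R -> Z) : Prop :=
  (forall t, 0 < t -> carrier E (u t)) /\
  exists s : nat -> R -> Z,
    (forall n, simple_in E (s n)) /\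
    {ae lebesgue_measure, forall t, 0 < t ->
      enorm E (s n t - u t) @[n --> \oo] --> 0%E}.

Definition simple_integrable (s : R -> Z) : Prop :=
  forall z, z != 0 ->
    (lebesgue_measure (pos `&` s @^-1` [set z]) < +oo)%E.

Definition simple_integral (s : R -> Z) : Z :=
  \sum_(z \in s @` pos)
    fine (lebesgue_measure (pos `&` s @^-1` [set z])) *: z.

Definition is_bochner_integral E (u : R -> Z) (f : Z) : Prop :=
  [/\ carrier E f, strongly_measurable E u &
      exists s : nat -> R -> Z,
        [/\ forall n, simple_in E (s n) /\ simple_integrable (s n),
            (\int[lebesgue_measure]_(t in pos) enorm E (s n t - u t)%R)%E
              @[n --> \oo] --> 0%E &
            enorm E (simple_integral (s n) - f) @[n --> \oo] --> 0%E]].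

Definition K_space E F (v : R -> R) : normed_subspace R Z :=
  let N f := L1norm (fun t => ((t^-1 * v t)%:E * Kfun E F f t)%E) in
  {| carrier := [set f | carrier (sum_space E F) f /\ (N f < +oo)%E];
     enorm := N |}.

(* f is the integral of u with respect to ds/s *)
Definition J_representation E F (f : Z) (u : R -> Z) : Prop :=
  strongly_measurable (inter_space E F) u /\
  is_bochner_integral (sum_space E F) (fun s => s^-1 *: u s) f.

Definition J_space E F (v : R -> R) : normed_subspace R Z :=
  let N f := ereal_inf
    [set L1norm (fun t => ((t^-1 * v t)%:E * Jfun E F (u t) t)%E)
      | u in J_representation E F f] in
  {| carrier := [set f | [/\ carrier (sum_space E F) f,
                             exists u, J_representation E F f u &
                             (N f < +oo)%E]];
     enorm := N |}.

End couples.

(** Banach spaces are taken over R; complex ones are covered by restriction of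
    scalars, which affects none of the notions above. *)
Definition compatible_couple (R : realType) (Z : topologicalLmodType R)
    (X0 X1 : completeNormedModType R)
    (i0 : {linear X0 -> Z}) (i1 : {linear X1 -> Z}) : Prop :=
  [/\ hausdorff_space Z,
      injective i0 /\ continuous i0 &
      injective i1 /\ continuous i1].

(* Main.v *)
Require Import Defs.
From HB Require Import structures.
From mathcomp Require Import all_boot all_order all_algebra.
From mathcomp Require Import all_classical all_reals all_analysis.
From mathcomp Require Import measurable_realfun ring lra.

Set Implicit Arguments.
Unset Strict Implicit.
Unset Printing Implicit Defensive.

Import Order.TTheory GRing.Theory Num.Theory.
Import numFieldTopology.Exports numFieldNormedType.Exports.

Local Open Scope classical_set_scope.
Local Open Scope ring_scope.

(** Why the theorem is true. Write K and J for the two functionals, and J_v and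
    K_v for the interpolation spaces with weight v. The statement follows from
    the cycle of continuous inclusions

      J_a  in  X_0 meet J_A  in  X_0 meet K_B  in  J_a.

    First inclusion ([Jspace_in_left], [Jspace_le]). Since a decreases to a
    positive limit, it dominates a positive constant and the weight A. So a
    representation f = int u(s) ds/s with finite a-weighted norm converges
    absolutely in X_0, and by completeness f lies in X_0.

    Second inclusion ([Jspace_sub_Kspace]). Subadditivity of K gives
    K(f, t) <= int min(1, t/s) J(u(s), s) ds/s. As B(t)/t = - A'(t), Tonelli's
    theorem reduces the claim to int - A'(t) min(1, t/s) dt <= C A(s). The part
    t > s telescopes, and for t < s slow variation makes the contributions of
    the blocks between powers of 4 a geometric series ([weight_bound]).

    Third inclusion ([Kspace_sub_Jspace]). Choose nodes 1 = t_0 > t_1 > ... at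
    which a doubles each time, up to constants ([jump_sequence]), and almost
    optimal decompositions f = g_j + h_j at t_j. Then h_0 and the differences
    h_j - h_(j-1) lie in the intersection and sum up to f. Placing the j-th of
    them on [t_j, 2 t_j) gives a representation u whose norm is bounded by
    the sum of a(t_j) K(f, t_(j-1)) ([J_decomposition]). Since a(t_j) is
    comparable with the increment A(t_(j-1)) - A(t_(j-2)) and K(f, .) increases,
    this sum is, apart from its first terms, at most a multiple of
    int - A'(t) K(f, t) dt. Nothing has to be done near infinity:
    f lies in X_0, so h_0 also does, and a single term suffices there.

    Both uses of A' rest on the fundamental theorem of calculus for locally
    absolutely continuous functions ([derivative_density]). Vectors are
    measured by extended norms, which are +oo outside the space, and norms of
    strongly measurable functions are integrated as lower integrals. *)

(** * Integrals of functions that need not be measurable *)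

Section lower_integral.
Context d (T : measurableType d) (R : realType) (mu : {measure set T -> \bar R}).
Local Open Scope ereal_scope.
Implicit Types (f g : T -> \bar R) (D : set T).

Import HBNNSimple.

(** The integral of a non-negative function is a supremum over the simple
    functions below it. Setting such a simple function to zero on a null set
    does not change its integral, so no measurability is needed for
    monotonicity. Norms and K-functionals of vector valued functions are
    compared in this way. *)
Lemma ge0_le_integral_ae D f g : measurable D ->
  (forall x, D x -> 0 <= f x) -> (forall x, D x -> 0 <= g x) ->
  {ae mu, forall x, D x -> f x <= g x} ->
  \int[mu]_(x in D) f x <= \int[mu]_(x in D) g x.
Proof.
move=> mD f0 g0 [N [mN N0 sN]].
rewrite !ge0_integralE//; apply: ge_ereal_sup => _ [h /= hf <-].
have mNC := measurableC mN.
apply: le_ereal_sup_tmp; exists (sintegral mu (proj_nnsfun h mNC)).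
  exists (proj_nnsfun h mNC) => // x; rewrite -mrestrict patchE.
  have [xN|xN] := boolP (x \in N).
    rewrite memNset /=; last by move=> /(_ (set_mem xN)).
    by rewrite patchE; case: ifPn => // /set_mem/g0.
  rewrite mem_set /=; last by move/mem_set; rewrite (negbTE xN).
  apply: le_trans (hf x) _; rewrite !patchE; case: ifPn => // xD.
  apply: contrapT => nfg; move/negP: xN; apply; apply/mem_set/sN => /= H.
  by apply: nfg; apply: H; exact: set_mem.
rewrite -!integralT_nnsfun le_eqVlt; apply/orP; left; apply/eqP.
apply: ae_eq_integral => //.
- by apply/measurable_EFinP.
- by apply/measurable_EFinP.
- exists N; split => // x /= H; apply: contrapT => xN; apply: H => _.
  by rewrite /= mindicE mem_set//= mulr1.
Qed.

Lemma ge0_le_lower_integral D f g : measurable D ->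
  (forall x, D x -> 0 <= f x) -> (forall x, D x -> f x <= g x) ->
  \int[mu]_(x in D) f x <= \int[mu]_(x in D) g x.
Proof.
move=> mD f0 fg; apply: ge0_le_integral_ae => //.
  by move=> x Dx; exact: le_trans (f0 _ Dx) (fg _ Dx).
exact: aeW.
Qed.

Lemma ge0_eq_integral_ae D f g : measurable D ->
  (forall x, D x -> 0 <= f x) -> (forall x, D x -> 0 <= g x) ->
  {ae mu, forall x, D x -> f x = g x} ->
  \int[mu]_(x in D) f x = \int[mu]_(x in D) g x.
Proof.
move=> mD f0 g0 fg; apply/eqP; rewrite eq_le; apply/andP; split;
  apply: ge0_le_integral_ae => //; apply: filterS fg => x + Dx => /(_ Dx) ->//.
Qed.

(** Norms of strongly measurable functions agree almost everywhere with Borel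
    functions, but need not be Borel themselves. *)
Definition aemeasurable D f :=
  exists2 g, measurable_fun D g & {ae mu, forall x, D x -> f x = g x}.

Lemma ae_measurable_ge0 D f : (forall x, D x -> 0 <= f x) ->
  aemeasurable D f -> exists g, [/\ measurable_fun D g,
    forall x, 0 <= g x & {ae mu, forall x, D x -> f x = g x}].
Proof.
move=> f0 [g mg fg]; exists (fun x => `|g x|); split => //.
  exact: measurableT_comp.
by apply: filterS fg => x + Dx => /(_ Dx) <-; rewrite gee0_abs// f0.
Qed.

Lemma ae_measurable_cvg D (f_ : (T -> \bar R)^nat) f : measurable D ->
  (forall n, measurable_fun D (f_ n)) ->
  {ae mu, forall x, D x -> f_ n x @[n --> \oo] --> f x} ->
  aemeasurable D f.
Proof.
move=> mD mf H; exists (fun x => limn_esup (f_ ^~ x)).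
  exact: measurable_fun_limn_esup.
apply: filterS H => x + Dx => /(_ Dx) /cvg_limn_einf_sup[_ ->]//.
Qed.

(** The lower integral is not subadditive in general. It is so on functions that
    agree almost everywhere with measurable ones. *)
Lemma ge0_integral_leD D f g h : measurable D ->
  (forall x, D x -> 0 <= f x) -> (forall x, D x -> 0 <= g x) ->
  (forall x, D x -> 0 <= h x) ->
  aemeasurable D f -> aemeasurable D g ->
  {ae mu, forall x, D x -> h x <= f x + g x} ->
  \int[mu]_(x in D) h x <= \int[mu]_(x in D) f x + \int[mu]_(x in D) g x.
Proof.
move=> mD f0 g0 h0 /ae_measurable_ge0-/(_ f0)[f' [mf' f'0 ff']].
move=> /ae_measurable_ge0-/(_ g0)[g' [mg' g'0 gg']] H.
rewrite (ge0_eq_integral_ae _ f0 _ ff')// (ge0_eq_integral_ae _ g0 _ gg')//.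
rewrite -ge0_integralD//; apply: ge0_le_integral_ae => //.
  by move=> x Dx; rewrite adde_ge0.
by apply: filterS3 ff' gg' H => x + + + Dx => /(_ Dx) <- /(_ Dx) <- /(_ Dx).
Qed.

(** Dividing a simple function below c f by c gives one below f. *)
Lemma ge0_integral_leZ D f (c : R) : measurable D -> (0 < c)%R ->
  (forall x, D x -> 0 <= f x) ->
  \int[mu]_(x in D) (c%:E * f x) <= c%:E * \int[mu]_(x in D) f x.
Proof.
move=> mD c0 f0; have cV0 : (0 <= c^-1)%R by rewrite invr_ge0 ltW.
rewrite !ge0_integralE//; last first.
  by move=> x Dx; rewrite mule_ge0 ?f0// lee_fin ltW.
apply: ge_ereal_sup => _ [h /= hf <-].
rewrite -lee_pdivrMl//; apply: ereal_sup_ubound.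
exists (scale_nnsfun h cV0); last by rewrite -sintegralrM.
move=> x /=; rewrite EFinM lee_pdivrMl//.
by apply: le_trans (hf x) _; rewrite !patchE; case: ifP; rewrite ?mule0.
Qed.

End lower_integral.

Global Instance ae_lebesgue_filter (R : realType) :
  Filter (nbhs (almost_everywhere (@lebesgue_measure R))).
Proof. exact: (ae_filter_ringOfSetsType (@lebesgue_measure R)). Qed.

Lemma measurable_pos (R : realType) : measurable (@pos R).
Proof. exact: measurable_itv. Qed.
#[global] Hint Resolve measurable_pos : core.

Lemma in_posE (R : realType) (x : R) : pos x = (0 < x) :> Prop.
Proof. by rewrite /pos /= in_itv/= andbT. Qed.

(** * Absolutely continuous monotone functions *)

Lemma measure_bigcupT d (T : measurableType d) (R : realType)
    (mu : {measure set T -> \bar R}) (F : nat -> set T) :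
  (forall i, measurable (F i)) -> trivIset setT F ->
  (mu (\bigcup_n F n) = \sum_(0 <= n <oo) mu (F n))%E.
Proof.
move=> mF tF; rewrite measure_bigcup//.
by apply: eq_eseriesl => k; rewrite in_setT.
Qed.

Section ftc_ac.
Context (R : realType).
Local Notation mu := (@lebesgue_measure R).
Variables (p q : R) (pq : p < q) (f : R -> R).
Hypothesis f_ni : forall s t, p <= s -> s <= t -> t <= q -> f t <= f s.
Hypothesis f_ac : abs_continuous_on p q f.

(** Projection onto [p, q], used to extend f to the whole line. *)
Let cl (x : R) := Num.min (Num.max x p) q.

Let cl_spec x : [\/ x <= p /\ cl x = p, p <= x <= q /\ cl x = x | q <= x /\ cl x = q].
Proof.
rewrite /cl; have [xp|px] := lerP x p.
  by constructor 1; split => //; apply/min_idPl; exact: ltW.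
have [xq|qx] := lerP x q; first by constructor 2; rewrite (ltW px).
by constructor 3; split => //; exact: ltW.
Qed.

Let cl_itv x : p <= cl x <= q.
Proof. by case: (cl_spec x) => -[? ->]//; rewrite ?lexx ltW. Qed.

Let cl_id x : p <= x -> x <= q -> cl x = x.
Proof. by rewrite /cl => ? ?; rewrite max_l// min_l. Qed.

Let cl_le x y : x <= y -> cl x <= cl y.
Proof.
have := pq; case: (cl_spec x) => -[? ->]; case: (cl_spec y) => -[? ->] *;
  try split; lra.
Qed.

Let cl_lip x y : x <= y -> cl y - cl x <= y - x.
Proof.
have := pq; case: (cl_spec x) => -[? ->]; case: (cl_spec y) => -[? ->] *;
  try split; lra.
Qed.

Let cl_sub x y z : cl x < z -> z < cl y -> x < z /\ z < y.
Proof.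
have := pq; case: (cl_spec x) => -[? ->]; case: (cl_spec y) => -[? ->] *;
  try split; lra.
Qed.

Let F x := - f (cl x).

Let F_nd : nondecreasing F.
Proof.
move=> x y xy; rewrite /F lerN2; apply: f_ni; [|exact: cl_le|].
  by have /andP[] := cl_itv x.
by have /andP[] := cl_itv y.
Qed.

Let F_cts : continuous F.
Proof.
move=> x; apply/cvgrPdist_lt => e e0.
have [d d0 H] := f_ac e0.
near=> y.
have xy : `|x - y| < d by near: y; apply/nbhs_ballP; exists d => // y; rewrite -ball_normE.
have K u v : u <= v -> v - u < d -> `|F u - F v| < e.
  move=> uv uvd; have := @H 1%N (fun=> cl u) (fun=> cl v).
  rewrite !big_ord1 => H1; rewrite /F opprK addrC; apply: H1.
  - move=> _; have /andP[-> _] := cl_itv u; have /andP[_ ->] := cl_itv v.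
    by rewrite cl_le.
  - by apply/trivIsetP => i j _ _; rewrite !ord1 eqxx.
  - exact: le_lt_trans (cl_lip uv) _.
have [xley|/ltW ylex] := leP x y.
  by apply: K => //; move: xy; rewrite distrC ger0_norm// subr_ge0.
by rewrite distrC; apply: K => //; move: xy; rewrite ger0_norm// subr_ge0.
Unshelve. all: by end_near. Qed.

Let F_rc : right_continuous F.
Proof. by move=> x; apply: cvg_at_right_filter; exact: F_cts. Qed.

HB.instance Definition _ := isCumulative.Build R _ R F F_nd F_rc.

Let nu := lebesgue_stieltjes_measure F.

Let nu_oc x y : x <= y -> nu `]x, y] = (F y - F x)%:E.
Proof.
move=> xy; rewrite /nu /lebesgue_stieltjes_measure /measure_extension/=.
by rewrite measurable_mu_extE//= ?wlength_itv_bnd//; exact: is_ocitv.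
Qed.

(** An open set is a disjoint union of open intervals. Projected onto [p, q],
    finitely many of them form a family to which the absolute continuity of f
    applies. *)
Let nu_open (e d m M : R) (V : set R) : open V -> V `<=` `[m, M] ->
  (forall (n : nat) (l r : 'I_n -> R),
      (forall i, [/\ p <= l i, l i <= r i & r i <= q]) ->
      trivIset setT (fun i => `]l i, r i[%classic) ->
      \sum_(i < n) (r i - l i) < d ->
      \sum_(i < n) `|f (r i) - f (l i)| < e) ->
  (mu V < d%:E)%E -> (nu V <= e%:E)%E.
Proof.
move=> oV VmM H muV.
pose I := open_disjoint_itv oV.
have VE : V = \bigcup_k I k := open_disjoint_itv_bigcup oV.
have IV k : I k `<=` V by rewrite VE => x Ix; exists k.
have tI : trivIset setT I by exact: open_disjoint_itv_trivIset.
have mI k : measurable (I k) by apply: open_measurable; exact: open_disjoint_itv_open.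
pose l k := inf (I k); pose r k := sup (I k).
have hl k : has_lbound (I k) by exists m => x /IV/VmM/=; rewrite in_itv/= => /andP[].
have hr k : has_ubound (I k) by exists M => x /IV/VmM/=; rewrite in_itv/= => /andP[].
have IE k : I k = `]l k, r k[%classic.
  rewrite -interval_bounded_interior//; last first.
    exact: open_disjoint_itv_is_interval.
  by apply/esym/interior_id; exact: open_disjoint_itv_open.
have lr k : l k <= r k.
  have [I0|/set0P[x Ix]] := eqVneq (I k) set0.
    by rewrite /l /r I0 inf0 sup0.
  by apply: (@le_trans _ _ x); [exact: ge_inf|exact: ub_le_sup].
have nuI k : (nu (I k) <= (F (r k) - F (l k))%:E)%E.
  rewrite -nu_oc//; apply: le_measure; rewrite ?inE//.
    exact: mI.
  by rewrite IE; exact: subset_itv_oo_oc.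
have -> : nu V = (\sum_(0 <= k <oo) nu (I k))%E.
  by rewrite {1}VE; exact: (measure_bigcupT (lebesgue_stieltjes_measure F)).
apply: lime_le; first by apply: is_cvg_nneseries => k _ _; exact: measure_ge0.
apply: nearW => n.
apply: (@le_trans _ _ (\sum_(0 <= k < n) (F (r k) - F (l k))%:E)%E).
  exact: lee_sum.
rewrite sumEFin lee_fin big_mkord.
have Fabs k : F (r k) - F (l k) = `|f (cl (r k)) - f (cl (l k))|.
  rewrite distrC ger0_norm /F ?opprK 1?addrC//.
  by have := F_nd (lr k); rewrite /F; lra.
under eq_bigr do rewrite Fabs.
apply/ltW/(H n (fun i => cl (l i)) (fun i => cl (r i))).
- move=> i; have /andP[-> _] := cl_itv (l i); have /andP[_ ->] := cl_itv (r i).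
  by rewrite cl_le.
- apply/trivIsetP => i j _ _ ij.
  move/trivIsetP : tI => /(_ i j Logic.I Logic.I ij).
  rewrite !IE -!subset0 => tij x [/=]; rewrite !in_itv/= => /andP[l1 r1] /andP[l2 r2].
  apply: (tij x); split => /=; rewrite in_itv/=.
    by have [-> ->] := cl_sub l1 r1.
  by have [-> ->] := cl_sub l2 r2.
- rewrite -lte_fin; apply: le_lt_trans muV.
  apply: (@le_trans _ _ (\sum_(k < n) mu (I k))%E).
    rewrite -sumEFin; apply: lee_sum => i _.
    rewrite IE lebesgue_measure_itv/= lte_fin.
    case: ltP => lri; first by rewrite lee_fin cl_lip.
    by rewrite lee_fin subr_le0 cl_le.
  rewrite -(big_mkord xpredT (fun k => mu (I k))).
  rewrite {1}VE (measure_bigcupT mu)//.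
  exact: (@nneseries_lim_ge _ (mu \o I) xpredT).
Qed.

(** A null set is covered by an open set of small measure, so its Stieltjes
    measure is small by the previous bound. *)
Let nu_null (N : set R) : measurable N -> mu N = 0 -> nu (N `&` `]p, q]) = 0.
Proof.
move=> mN N0; apply/eqP; rewrite eq_le measure_ge0 andbT.
apply/lee_addgt0Pr => e e0; rewrite add0e.
have [d d0 H] := f_ac e0.
have muN : (mu N < +oo)%E by rewrite N0 ltry.
have [U [oU NU mUN]] := @lebesgue_regularity_outer R N d mN muN d0.
have oV : open (U `&` `]p - 1, q + 1[) by apply: openI => //; exact: interval_open.
apply: (@le_trans _ _ (nu (U `&` `]p - 1, q + 1[))).
  apply: le_measure; rewrite ?inE.
  - exact: measurableI.
  - exact: open_measurable.
  - move=> x [/NU Ux] /=; rewrite in_itv/= => /andP[px xq]; split => //=.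
    by rewrite in_itv/=; apply/andP; split; lra.
apply: (nu_open oV _ H).
  by move=> x [_] /=; apply: subset_itv_oo_cc.
have mU : measurable U by exact: open_measurable.
have mV : measurable (U `&` `]p - 1, q + 1[) by exact: open_measurable.
have UN0 : mu (U `&` N) = 0.
  apply/eqP; rewrite eq_le measure_ge0 andbT -N0.
  by apply: le_measure; rewrite ?inE//; exact: measurableI.
have muU : (mu U <= mu (U `\` N))%E.
  apply: (@le_trans _ _ (mu (U `\` N) + mu (U `&` N))%E).
    by rewrite -measureDI.
  by rewrite UN0 adde0.
apply: le_lt_trans mUN; apply: le_trans muU.
by apply: le_measure; rewrite ?inE.
Qed.

Let mD : measurable (`]p, q]%classic : set (measurableTypeR R)).
Proof. exact: measurable_itv. Qed.

Let nuD : (nu `]p, q] < +oo)%E.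
Proof. by rewrite nu_oc ?ltry// ltW. Qed.

(** The Stieltjes measure of minus f (extended by constants outside [p, q]) is
    absolutely continuous with respect to Lebesgue measure. Its Radon-Nikodym
    density g has the increments of f as integrals, and Lebesgue's
    differentiation theorem identifies g with minus the derivative of f. *)
Lemma abs_continuous_density : exists g : R -> R, [/\
  forall x, 0 <= g x,
  mu.-integrable setT (EFin \o g),
  forall x y, p <= x -> x <= y -> y <= q ->
    (\int[mu]_(t in `]x, y]) (g t)%:E = (f x - f y)%:E)%E &
  {ae mu, forall x, p < x -> x < q -> derive1 f x = - g x}].
Proof.
have dom : mfrestr mD nuD `<< lebesgue_measure.
  by apply/null_content_dominatesP => N mN N0; exact: nu_null.
have [g0 [g0_ge0 g0_fin g0_int g0E]] := radon_nikodym_sigma_finite dom.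
pose g x := fine (g0 x).
have gE x : g0 x = (g x)%:E by rewrite /g fineK.
have ig : mu.-integrable setT (EFin \o g).
  by apply: eq_integrable g0_int => // x _ /=; rewrite gE.
have intg x y : p <= x -> x <= y -> y <= q ->
    (\int[mu]_(t in `]x, y]) (g t)%:E = (f x - f y)%:E)%E.
  move=> px xy yq.
  transitivity (mfrestr mD nuD `]x, y]).
    by rewrite g0E//; apply: eq_integral => t _; rewrite gE.
  rewrite /mfrestr /mrestr /= setIidl.
    rewrite nu_oc// /F !cl_id//; first by rewrite opprK addrC.
    - exact: le_trans xy yq.
    - exact: le_trans px xy.
  by move=> t /=; rewrite !in_itv/= => /andP[xt ty]; rewrite (le_lt_trans px xt) (le_trans ty yq).
exists g; split => //.
  by move=> x; rewrite -lee_fin -gE.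
have lg : locally_integrable setT g.
  by apply: open_integrable_locally => //; exact: openT.
have := lebesgue_differentiation lg; apply: filterS => x gx px xq.
have ig' : mu.-integrable [set` Interval (BRight p) (BRight q)] (EFin \o g).
  by apply: integrableS ig.
have [dG GE] := @FTC1_lebesgue_pt R g (BRight p) x q xq ig' px gx.
rewrite -GE.
set G := fun y => _ in dG *.
have nG : {near x, f =1 (fun y => f p - G y)}.
  near=> y.
  have py : p <= y by apply: ltW; near: y; exact: lt_nbhsr.
  have yq : y <= q by apply: ltW; near: y; exact: lt_nbhsl.
  rewrite /G /Rintegral intg// /=; lra.
rewrite derive1E (near_eq_derive _ nG) ?oner_eq0//.
rewrite (@deriveB _ _ _ (cst (f p)) G)//.
by rewrite derive_cst sub0r -derive1E.
Unshelve. all: by end_near. Qed.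

End ftc_ac.

Section dens.
Context (R : realType).
Local Notation mu := (@lebesgue_measure R).

(** The densities on the intervals [1/q, q] all agree with the derivative
    almost everywhere, so for almost every x they are eventually constant as q
    tends to infinity. Their limit is a global density. *)
Lemma derivative_density (A : R -> R) :
  (forall s t, 0 < s -> s <= t -> A t <= A s) -> locally_abs_continuous A ->
  exists h : R -> \bar R, [/\
    measurable_fun setT h,
    forall x, (0 <= h x)%E,
    {ae (@lebesgue_measure R), forall x, pos x -> `|derive1 A x|%:E = h x} &
    forall x y, 0 < x -> x <= y ->
      (\int[lebesgue_measure]_(t in `]x, y]) h t = (A x - A y)%:E)%E].
Proof.
move=> A_ni A_ac.
have mpos : measurable (@pos R) by exact: measurable_itv.
pose q (n : nat) : R := n.+2%:R.
have q1 n : 1 < q n by rewrite /q ltr1n.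
have q0 n : 0 < q n by rewrite (lt_trans _ (q1 n)).
have pq n : (q n)^-1 < q n by rewrite (lt_trans _ (q1 n))// invf_lt1.
have dens n : exists g : R -> R, [/\
    forall x, 0 <= g x, mu.-integrable setT (EFin \o g),
    forall x y, (q n)^-1 <= x -> x <= y -> y <= q n ->
      (\int[mu]_(t in `]x, y]) (g t)%:E = (A x - A y)%:E)%E &
    {ae mu, forall x, (q n)^-1 < x -> x < q n -> derive1 A x = - g x}].
  apply: abs_continuous_density => //.
    by move=> s t ps st _; apply: A_ni => //; apply: lt_le_trans ps; rewrite invr_gt0.
  by apply: A_ac; [rewrite invr_gt0|exact: ltW].
have [g /all_and4[g0 ig gE gA]] := choice dens.
have qbig x : 0 < x -> \forall n \near \oo, (q n)^-1 < x /\ x < q n.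
  move=> x0; near=> n; split.
    rewrite invf_plt ?posrE//; apply: lt_le_trans (_ : n%:R <= _).
      by near: n; exact: nbhs_infty_gtr.
    by rewrite ler_nat; exact/leqW/leqW.
  apply: lt_le_trans (_ : n%:R <= _).
    by near: n; exact: nbhs_infty_gtr.
  by rewrite ler_nat; exact/leqW/leqW.
have mh : aemeasurable mu pos (fun x => `|derive1 A x|%:E).
  apply: (@ae_measurable_cvg _ _ _ mu pos (fun n x => (g n x)%:E)) => //.
    by move=> n; apply: measurable_funTS; exact: measurable_int (ig n).
  have := ae_foralln gA; apply: filterS => x gx; rewrite in_posE => x0.
  apply: cvg_near_cst; near=> n; congr EFin.
  have [qx xq] : (q n)^-1 < x /\ x < q n by near: n; exact: qbig.
  by rewrite (gx n)// normrN ger0_norm.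
have f0 x : pos x -> (0 <= `|derive1 A x|%:E)%E by rewrite lee_fin.
have [h [mh' h0 hE]] := ae_measurable_ge0 (mu := mu) f0 mh.
exists (h \_ pos); split.
- by apply/(measurable_restrictT h) => //; exact: measurable_pos.
- by move=> x; rewrite patchE; case: ifP.
- by apply: filterS hE => x hx x0; rewrite patchE mem_set// hx.
move=> x y x0 xy.
have [n [qx _ _ yq]] : exists n, [/\ (q n)^-1 < x, x < q n, (q n)^-1 < y & y < q n].
  have y0 := lt_le_trans x0 xy.
  have [n _ /(_ _ (leqnn n))] := filterI (qbig x x0) (qbig y y0).
  by move=> [[? ?] [? ?]]; exists n.
rewrite -(gE n _ _ (ltW qx) xy (ltW yq)).
apply: ge0_eq_integral_ae => //.
- by move=> t _; rewrite patchE; case: ifP.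
- by move=> t _; rewrite lee_fin.
apply: filterS2 hE (gA n) => t ht gt; rewrite /= in_itv/= => /andP[xt yt].
have t0 : pos t by rewrite in_posE (lt_trans x0).
rewrite patchE mem_set// -ht// gt ?normrN ?ger0_norm//.
  exact: lt_trans xt.
exact: le_lt_trans yq.
Unshelve. all: by end_near.
Qed.

End dens.

(** * Extended seminorms and the K- and J-functionals *)

Section extended_seminorm.
Local Open Scope ereal_scope.
Context {R : realType} {Z : lmodType R}.
Implicit Types (N : Z -> \bar R) (A B : set (\bar R)) (E F : normed_subspace R Z).

(** The value +oo encodes that a vector lies outside the space. Since 0 * +oo
    = 0, homogeneity also holds for r = 0. *)
Definition ext_seminorm N := [/\ forall z, 0 <= N z,
  forall y z, N (y + z)%R <= N y + N z &
  forall (r : R) z, N (r *: z)%R = `|r|%:E * N z].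

Section theory.
Variables (N : Z -> \bar R) (hN : ext_seminorm N).

Lemma esn_ge0 z : 0 <= N z. Proof. by have [] := hN. Qed.

Lemma esnD y z : N (y + z)%R <= N y + N z. Proof. by have [] := hN. Qed.

Lemma esnZ (r : R) z : N (r *: z)%R = `|r|%:E * N z. Proof. by have [] := hN. Qed.

Lemma esn0 : N 0%R = 0.
Proof. by rewrite -(scale0r 0%R) esnZ normr0 mul0e. Qed.

Lemma esnN z : N (- z)%R = N z.
Proof. by rewrite -scaleN1r esnZ normrN1 mul1e. Qed.

Lemma esnBC y z : N (y - z)%R = N (z - y)%R.
Proof. by rewrite -esnN opprB. Qed.

Lemma esnB y z : N (y - z)%R <= N y + N z.
Proof. by rewrite -(esnN z); exact: esnD. Qed.

Lemma esn_trans x y z : N (x - z)%R <= N (x - y)%R + N (y - z)%R.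
Proof. by apply: le_trans (esnD _ _); rewrite addrA subrK. Qed.

Lemma esn_sum (I : Type) (s : seq I) (P : pred I) (f : I -> Z) :
  N (\sum_(i <- s | P i) f i)%R <= \sum_(i <- s | P i) N (f i).
Proof.
elim/big_ind2 : _ => // [|x1 x2 y1 y2 H1 H2]; first by rewrite esn0.
by apply: le_trans (esnD _ _) _; exact: leeD.
Qed.

End theory.

(** The triangle inequality for infima over decompositions. *)
Lemma ereal_inf_leD A B (x : \bar R) :
  (forall a, A a -> 0 <= a) -> (forall b, B b -> 0 <= b) ->
  (forall a b, A a -> B b -> x <= a + b) -> x <= ereal_inf A + ereal_inf B.
Proof.
move=> A0 B0 H.
have iA0 : 0 <= ereal_inf A by apply: le_ereal_inf_tmp.
have K b : B b -> x <= ereal_inf A + b.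
  move=> Bb; have b0 := B0 _ Bb; case: b Bb b0 => [b||//] Bb b0; last first.
    by rewrite addey ?leey// gt_eqF// (lt_le_trans _ iA0).
  rewrite -leeBlDr//; apply: le_ereal_inf_tmp => a Aa.
  by rewrite leeBlDr//; exact: H.
have iB0 : 0 <= ereal_inf B by apply: le_ereal_inf_tmp.
move: (ereal_inf A) iA0 K => [a||//] iA0 K; last first.
  by rewrite addye ?leey// gt_eqF// (lt_le_trans _ iB0).
rewrite -leeBlDl//; apply: le_ereal_inf_tmp => b Bb.
by rewrite leeBlDl//; exact: K.
Qed.

Lemma ereal_inf_leM A (r : R) (x : \bar R) : (0 < r)%R ->
  (forall a, A a -> x <= r%:E * a) -> x <= r%:E * ereal_inf A.
Proof.
move=> r0 H; rewrite -lee_pdivrMl//; apply: le_ereal_inf_tmp => a Aa.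
by rewrite lee_pdivrMl//; exact: H.
Qed.

Lemma ext_seminormI N : (forall z, 0 <= N z) -> N 0%R = 0 ->
  (forall y z, N (y + z)%R <= N y + N z) ->
  (forall (r : R) z, r != 0%R -> N (r *: z)%R <= `|r|%:E * N z) ->
  ext_seminorm N.
Proof.
move=> N0 N00 ND NZ; split => // r z.
have [->|r0] := eqVneq r 0%R; first by rewrite scale0r normr0 mul0e.
apply/eqP; rewrite eq_le NZ//= -lee_pdivlMl ?normr_gt0//.
rewrite -[in leLHS](scalerK r0 z) -normfV.
by apply: NZ; rewrite invr_eq0.
Qed.

Definition seminormed E :=
  ext_seminorm (enorm E) /\ forall z, carrier E z <-> enorm E z < +oo.

Lemma seminormed_embedded (X : normedModType R) (i : {linear X -> Z}) :
  seminormed (embedded i).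
Proof.
have H0 z a : [set `|x|%:E | x in i @^-1` [set z]] a -> 0 <= a.
  by move=> [x _ <-]; rewrite lee_fin.
split; last first.
  move=> z; split=> [[x _ <-]|/ereal_inf_lt[_ [x <- _] _]]; last by exists x.
  by apply: le_lt_trans (ltry `|x|); apply: ereal_inf_lbound; exists x.
apply: ext_seminormI => /=.
- by move=> z; apply: le_ereal_inf_tmp => a /H0.
- apply/eqP; rewrite eq_le; apply/andP; split.
    by apply: ereal_inf_lbound; exists 0%R; rewrite /= ?linear0 ?normr0.
  by apply: le_ereal_inf_tmp => a /H0.
- move=> y z; apply: ereal_inf_leD; [exact: H0|exact: H0|].
  move=> _ _ [a <- <-] [b <- <-]; apply: (@le_trans _ _ `|a + b|%:E).
    by apply: ereal_inf_lbound; exists (a + b)%R => //=; rewrite linearD.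
  by rewrite -EFinD lee_fin ler_normD.
- move=> r z r0; apply: ereal_inf_leM; first by rewrite normr_gt0.
  move=> _ [a <- <-]; rewrite -EFinM -normrZ; apply: ereal_inf_lbound.
  by exists (r *: a)%R => //=; rewrite linearZ.
Qed.

Lemma enorm_embedded (X : normedModType R) (i : {linear X -> Z}) x :
  injective i -> enorm (embedded i) (i x) = `|x|%:E.
Proof.
move=> ii; rewrite /= (_ : [set _ | _ in _] = [set `|x|%:E]) ?ereal_inf1//.
by apply/seteqP; split => [_ [y /ii <- <-]//|_ ->]; exists x.
Qed.

Section couple.
Variables (E F : normed_subspace R Z).
Hypotheses (hE : seminormed E) (hF : seminormed F).
Local Notation NE := (enorm E).
Local Notation NF := (enorm F).
Local Notation K := (Kfun E F).

Let E0 z : 0 <= NE z. Proof. exact: esn_ge0 hE.1 _. Qed.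
Let F0 z : 0 <= NF z. Proof. exact: esn_ge0 hF.1 _. Qed.

(** If y or z lies outside its space, the right-hand side is +oo. *)
Lemma Kfun_le (t : R) y z : (0 < t)%R -> K (y + z)%R t <= NE y + t%:E * NF z.
Proof.
move=> t0; have [yE|yE] := pselect (carrier E y); last first.
  rewrite (_ : NE y = +oo) ?addye ?leey//.
    by rewrite gt_eqF// (@lt_le_trans _ _ 0)// mule_ge0// lee_fin ltW.
  by apply/eqP; rewrite -leye_eq leNgt; apply/negP => /hE.2.
have [zF|zF] := pselect (carrier F z); last first.
  have -> : NF z = +oo.
    by apply/eqP; rewrite -leye_eq leNgt; apply/negP => /hF.2.
  rewrite gt0_muley ?lte_fin// addey ?leey//.
  by rewrite gt_eqF// (@lt_le_trans _ _ 0).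
by apply: ereal_inf_lbound; exists (y, z).
Qed.

Let Kset_ge0 (t : R) f a : (0 < t)%R ->
  [set (NE p.1 + t%:E * NF p.2)%E | p in decomp E F f] a -> 0 <= a.
Proof. by move=> t0 [p _ <-]; rewrite adde_ge0// mule_ge0// lee_fin ltW. Qed.

Lemma Kfun_ge0 (t : R) f : (0 < t)%R -> 0 <= K f t.
Proof. by move=> t0; apply: le_ereal_inf_tmp => a /Kset_ge0; exact. Qed.

Lemma Kfun_seminorm (t : R) : (0 < t)%R -> ext_seminorm (K ^~ t).
Proof.
move=> t0; apply: ext_seminormI.
- by move=> z; exact: Kfun_ge0.
- apply/eqP; rewrite eq_le Kfun_ge0// andbT.
  by rewrite -[X in K X](addr0 0%R) (le_trans (Kfun_le _ _ t0))//
    (esn0 hE.1) (esn0 hF.1) mule0 adde0.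
- move=> y z; apply: ereal_inf_leD.
  + by move=> a; exact: Kset_ge0.
  + by move=> a; exact: Kset_ge0.
  move=> _ _ [p [_ _ ->] <-] [q [_ _ ->] <-].
  rewrite addrACA; apply: le_trans (Kfun_le _ _ t0) _.
  rewrite addeACA leeD ?(esnD hE.1)// -ge0_muleDr//.
  by apply: lee_wpmul2l; [rewrite lee_fin ltW|exact: esnD hF.1 _ _].
- move=> r z r0; apply: ereal_inf_leM; first by rewrite normr_gt0.
  move=> _ [p [_ _ ->] <-]; rewrite scalerDr.
  apply: le_trans (Kfun_le _ _ t0) _.
  rewrite (esnZ hE.1) (esnZ hF.1) ge0_muleDr//; last first.
    by rewrite mule_ge0// lee_fin ltW.
  by rewrite muleCA.
Qed.

Lemma Kfun_le0 (t : R) z : (0 < t)%R -> K z t <= NE z.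
Proof.
by move=> t0; rewrite -[X in K X](addr0 z) (le_trans (Kfun_le _ _ t0))// (esn0 hF.1) mule0 adde0.
Qed.

Lemma Kfun_le1 (t : R) z : (0 < t)%R -> K z t <= t%:E * NF z.
Proof.
by move=> t0; rewrite -[X in K X](add0r z) (le_trans (Kfun_le _ _ t0))// (esn0 hE.1) add0e.
Qed.

Lemma Kfun_mono (s t : R) z : (s <= t)%R -> K z s <= K z t.
Proof.
move=> st; apply: le_ereal_inf_tmp => _ [p pd <-].
apply: (@le_trans _ _ (NE p.1 + s%:E * NF p.2)).
  by apply: ereal_inf_lbound; exists p.
by rewrite leeD2l// lee_wpmul2r// lee_fin.
Qed.

(** A decomposition for the parameter s is also one for t, and costs at most
    t / s times as much. Hence all K(., t) are equivalent to the norm of the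
    sum. *)
Lemma Kfun_scale (s t : R) z : (0 < s)%R -> (s <= t)%R -> K z t <= (t / s)%:E * K z s.
Proof.
move=> s0 st; have t0 := lt_le_trans s0 st.
apply: ereal_inf_leM; first exact: divr_gt0.
move=> _ [p pd <-]; apply: (@le_trans _ _ (NE p.1 + t%:E * NF p.2)).
  by apply: ereal_inf_lbound; exists p.
rewrite ge0_muleDr//; last by rewrite mule_ge0// lee_fin ltW.
rewrite muleA -EFinM divfK ?gt_eqF// leeD2r//.
by rewrite lee_pemull// lee_fin ler_pdivlMr// mul1r.
Qed.

Lemma Kfun_lty (t : R) z : (0 < t)%R -> carrier (sum_space E F) z <-> K z t < +oo.
Proof.
move=> t0; split=> [[p pd]|/ereal_inf_lt[_ [p pd _] _]]; last by exists p.
apply: le_lt_trans (ereal_inf_lbound _) _; first by exists p.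
by case: pd => /hE.2 ? /hF.2 ? _; rewrite lte_add_pinfty// lte_mul_pinfty// lee_fin ltW.
Qed.

Lemma sum_enormE z : enorm (sum_space E F) z = K z 1.
Proof.
rewrite /= /Kfun; congr ereal_inf; apply/seteqP; split => _ [p pd <-];
  by exists p; rewrite ?mul1e.
Qed.

Lemma seminormed_sum : seminormed (sum_space E F).
Proof.
have NE1 : enorm (sum_space E F) = K ^~ 1%R by apply/funext => z; exact: sum_enormE.
by split; [rewrite NE1; exact: Kfun_seminorm|move=> z; rewrite NE1; exact: Kfun_lty ltr01].
Qed.

Lemma Jfun_seminorm (t : R) : (0 < t)%R -> ext_seminorm (fun z => Jfun E F z t).
Proof.
move=> t0; have t0' : 0 <= t%:E by rewrite lee_fin ltW.
apply: ext_seminormI; rewrite /Jfun.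
- by move=> z; rewrite le_max E0.
- by rewrite (esn0 hE.1) (esn0 hF.1) mule0 maxxx.
- move=> y z; rewrite ge_max; apply/andP; split.
    by rewrite (le_trans (esnD hE.1 _ _))// leeD// le_max lexx.
  rewrite (le_trans (lee_wpmul2l _ (esnD hF.1 _ _)))// ge0_muleDr//.
  by rewrite leeD// le_max lexx orbT.
- move=> r z _; rewrite (esnZ hE.1) (esnZ hF.1) muleCA maxe_pMr//.
Qed.

Lemma seminormed_inter : seminormed (inter_space E F).
Proof.
have NJ : enorm (inter_space E F) = fun z => Jfun E F z 1.
  by apply/funext => z; rewrite /= /Jfun mul1e.
split; first by rewrite NJ; exact: Jfun_seminorm.
by move=> z /=; rewrite gt_max; split => [[/hE.2-> /hF.2]//|/andP[/hE.2 ? /hF.2]].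
Qed.

(** Both trivial decompositions z = z + 0 and z = 0 + z are admissible. *)
Lemma Kfun_leJ (s t : R) z : (0 < s)%R -> (0 < t)%R ->
  K z t <= (Num.min 1 (t / s))%:E * Jfun E F z s.
Proof.
move=> s0 t0; have [_|_] := leP 1%R (t / s)%R.
  by rewrite mul1e (le_trans (Kfun_le0 _ t0))// le_max lexx.
apply: (le_trans (Kfun_le1 _ t0)).
have ts : (t = t / s * s)%R by rewrite divfK// gt_eqF.
rewrite [X in X%:E * NF _ <= _]ts EFinM -muleA.
apply: lee_wpmul2l; first by rewrite lee_fin divr_ge0// ltW.
by rewrite le_max lexx orbT.
Qed.

End couple.

End extended_seminorm.

(** * Functions with finitely many values *)

Section simple_maps.
Context {R : realType}.
Local Notation mu := (@lebesgue_measure R).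
Local Open Scope ereal_scope.

Definition fiber {T : Type} (p : R -> T) (y : T) : set R := pos `&` p @^-1` [set y].

(** Values in an arbitrary type make it possible to refine several simple
    functions to a common one, by pairing them. *)
Definition simple_map {T : Type} (p : R -> T) : Prop :=
  finite_set (p @` pos) /\ forall y, measurable (fiber p y).

Lemma preimage_bigcup_fiber {T : choiceType} (p : R -> T) (A : set T) :
  pos `&` p @^-1` A = \bigcup_(y in (p @` pos) `&` A) fiber p y.
Proof.
apply/seteqP; split => [t [t0 At]|t [y [_ Ay] [t0 /= pt]]]; last by split => //=; rewrite pt.
by exists (p t) => //; split => //; exists t.
Qed.

Lemma simple_map_measurable {T : choiceType} (p : R -> T) (A : set T) : simple_map p ->
  measurable (pos `&` p @^-1` A).
Proof.
move=> sp; rewrite preimage_bigcup_fiber; apply: fin_bigcup_measurable.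
  exact: finite_setIl sp.1.
by move=> y _; exact: sp.2.
Qed.

Lemma simple_map_comp {T : choiceType} {U : Type} (p : R -> T) (phi : T -> U) :
  simple_map p -> simple_map (phi \o p).
Proof.
move=> sp; split; last by move=> y; exact: (simple_map_measurable (phi @^-1` [set y]) sp).
by rewrite -image_comp; exact: finite_image sp.1.
Qed.

Lemma simple_map_pair {T U : choiceType} (p : R -> T) (q : R -> U) :
  simple_map p -> simple_map q -> simple_map (fun t => (p t, q t)).
Proof.
move=> sp sq; split.
  apply: sub_finite_set (finite_setX sp.1 sq.1).
  by move=> _ [t t0 <-]; split => /=; exists t.
move=> [y z]; rewrite (_ : fiber _ _ = fiber p y `&` fiber q z).
  by apply: measurableI; [exact: sp.2|exact: sq.2].
by apply/seteqP; split => [t [t0 [<- <-]]//|t [[t0 <-] [_ <-]]].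
Qed.

Lemma measurable_simple_map {T : choiceType} (p : R -> T) (phi : T -> \bar R) :
  simple_map p -> measurable_fun pos (phi \o p).
Proof. by move=> sp _ A mA; exact: (simple_map_measurable (phi @^-1` A) sp). Qed.

Lemma trivIset_fiber {T : Type} (p : R -> T) (A : set T) : trivIset A (fiber p).
Proof. by move=> y z _ _ [t [[_ /= <-] [_ /= <-]]]. Qed.

Lemma measure_preimage {T : choiceType} (p : R -> T) (A : set T) : simple_map p ->
  mu (pos `&` p @^-1` A) =
  \sum_(y \in p @` pos) (if y \in A then mu (fiber p y) else 0).
Proof.
move=> sp; rewrite preimage_bigcup_fiber -fsbig_setU; last exact: finite_setIl sp.1.
rewrite measure_fsbig.
- by rewrite fsbig_mkcondr.
- exact: finite_setIl sp.1.
- by move=> y _; exact: sp.2.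
- exact: trivIset_fiber.
Qed.

Lemma integral_simple_map {T : choiceType} (p : R -> T) (phi : T -> \bar R) :
  simple_map p -> (forall y, 0 <= phi y) ->
  \int[mu]_(t in pos) phi (p t) = \sum_(y \in p @` pos) phi y * mu (fiber p y).
Proof.
move=> sp phi0; set P := p @` pos.
have posU : \big[setU/set0]_(y <- finmap.enum_fset (fset_set P)) fiber p y = pos.
  rewrite (bigsetU_fset_set _ sp.1) -[RHS]setIT -(preimage_setT p).
  by rewrite preimage_bigcup_fiber setIT.
rewrite -[X in integral _ X _]posU ge0_integral_bigsetU//.
- rewrite fsbig_finite//; last exact: sp.1.
  apply: eq_bigr => y _; rewrite -(integral_cst mu) ?fun_true//; last exact: sp.2.
  by apply: eq_integral => t; rewrite inE => -[_ /= ->].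
- exact: sp.2.
- exact: trivIset_fiber.
- by rewrite posU; exact: measurable_simple_map.
Qed.

(** The integral may be computed on any finer partition into measurable sets.
    Only the fibers on which phi vanishes may have infinite measure, and these
    contribute nothing. *)
Lemma simple_integral_comp {Z : lmodType R} {T : choiceType} (p : R -> T)
    (phi : T -> Z) : simple_map p ->
  (forall y, phi y != 0%R -> mu (fiber p y) < +oo) ->
  simple_integral (phi \o p) =
  (\sum_(y \in p @` pos) fine (mu (fiber p y)) *: phi y)%R.
Proof.
move=> sp fin; rewrite /simple_integral; set P := p @` pos.
have fP : finite_set P by exact: sp.1.
have fQ : finite_set ((phi \o p) @` pos) by rewrite -image_comp; exact: finite_image.
transitivity (\sum_(z \in (phi \o p) @` pos)
   \sum_(y \in P) (if phi y == z then fine (mu (fiber p y)) *: phi y else 0))%R.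
  apply: eq_fsbigr => z _.
  have [->|z0] := eqVneq z 0%R.
    rewrite scaler0 fsbig1// => y _; case: eqP => // ->; by rewrite scaler0.
  rewrite (_ : pos `&` _ = pos `&` p @^-1` [set y | phi y = z])//.
  rewrite measure_preimage//.
  transitivity (fine (\sum_(y \in P)
      (if phi y == z then fine (mu (fiber p y)) else 0%R)%:E) *: z)%R.
    congr (fine _ *: _)%R; apply: eq_fsbigr => y _.
    have [yz|yz] := eqVneq (phi y) z; last by rewrite memNset//; apply/eqP.
    by rewrite mem_set//= fineK// ge0_fin_numE// fin// yz.
  rewrite fsumEFin//= !fsbig_finite//= scaler_suml.
  by apply: eq_bigr => y _; case: eqP => [->|]; rewrite ?scale0r.
rewrite exchange_fsbig//; apply: eq_fsbigr => y; rewrite inE => -[t t0 <-].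
rewrite (fsbigD1 (phi (p t)))//=; last by exists t.
rewrite eqxx fsbig1 ?addr0// => z [_ /= zp]; case: eqP => // e.
by case: zp.
Qed.

Lemma esn_simple_integral {Z : lmodType R} (N : Z -> \bar R) {T : choiceType} (p : R -> T)
    (phi : T -> Z) : ext_seminorm N -> simple_map p ->
  (forall y, phi y != 0%R -> mu (fiber p y) < +oo) ->
  N (simple_integral (phi \o p)) <= \int[mu]_(t in pos) N (phi (p t)).
Proof.
move=> hN sp fin; rewrite simple_integral_comp//.
rewrite (integral_simple_map (phi := N \o phi) sp)//=; last by move=> y; exact: esn_ge0 hN _.
rewrite !fsbig_finite//=; try exact: sp.1.
apply: le_trans (esn_sum hN _ _ _) _; apply: lee_sum => y _.
rewrite (esnZ hN) muleC ger0_norm ?fine_ge0//.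
have [->|y0] := eqVneq (phi y) 0%R; first by rewrite (esn0 hN) !mul0e.
by rewrite fineK// ge0_fin_numE// fin.
Qed.

(** Both integrals are computed on the common refinement of the two simple
    functions. *)
Lemma esn_simple_integralB {Z : lmodType R} (N : Z -> \bar R) (s1 s2 : R -> Z) :
  ext_seminorm N -> simple_map s1 -> simple_map s2 ->
  simple_integrable s1 -> simple_integrable s2 ->
  N (simple_integral s1 - simple_integral s2)%R <=
    \int[mu]_(t in pos) N (s1 t - s2 t)%R.
Proof.
move=> hN m1 m2 i1 i2; pose p t := (s1 t, s2 t).
have sp : simple_map p by exact: simple_map_pair.
have fin1 y : y.1 != 0%R -> mu (fiber p y) < +oo.
  move=> y0; apply: le_lt_trans (i1 _ y0); apply: le_measure; rewrite ?inE.
  - exact: sp.2.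
  - exact: m1.2.
  - by move=> t [t0 /= <-].
have fin2 y : y.2 != 0%R -> mu (fiber p y) < +oo.
  move=> y0; apply: le_lt_trans (i2 _ y0); apply: le_measure; rewrite ?inE.
  - exact: sp.2.
  - exact: m2.2.
  - by move=> t [t0 /= <-].
have finB y : (y.1 - y.2)%R != 0%R -> mu (fiber p y) < +oo.
  have [->|/fin1//] := eqVneq y.1 0%R.
  by rewrite sub0r oppr_eq0; exact: fin2.
apply: le_trans (esn_simple_integral hN sp finB).
have E1 := simple_integral_comp sp fin1.
have E2 := simple_integral_comp sp fin2.
have EB := simple_integral_comp sp finB.
rewrite EB [simple_integral s1]E1 [simple_integral s2]E2.
rewrite !fsbig_finite//; try exact: sp.1.
rewrite -sumrB le_eqVlt; apply/orP; left; apply/eqP; congr N.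
by apply: eq_bigr => y _; rewrite scalerBr.
Qed.

Lemma esn_simple_integral_le {Z : lmodType R} (N : Z -> \bar R) (s : R -> Z) :
  ext_seminorm N -> simple_map s -> simple_integrable s ->
  N (simple_integral s) <= \int[mu]_(t in pos) N (s t).
Proof. by move=> hN ms si; exact: (esn_simple_integral (phi := id) hN ms si). Qed.

End simple_maps.

(** * Strongly measurable functions *)

Section ereal_convergence.
Context {R : realType}.
Local Open Scope ereal_scope.

(** Convergence to 0 of non-negative extended reals, without reference to the
    topology of the extended line. *)
Lemma nncvg0P (f : (\bar R)^nat) : (forall n, 0 <= f n) ->
  (f n @[n --> \oo] --> 0) <->
  (forall e : R, (0 < e)%R -> \forall n \near \oo, f n < e%:E).
Proof.
move=> f0; split.
  move=> /fine_cvgP[ff /cvgrPdist_lt fc] e e0; move: (fc _ e0) ff.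
  apply: filterS2 => n /=; rewrite sub0r normrN ger0_norm ?fine_ge0// => fe fn.
  by rewrite -(fineK fn) lte_fin.
move=> H; apply/fine_cvgP; split.
  apply: filterS (H 1%R ltr01) => n fn1.
  by rewrite ge0_fin_numE// (lt_trans fn1)// ltry.
apply/cvgrPdist_lt => e e0; apply: filterS (H e e0) => n fne /=.
rewrite sub0r normrN ger0_norm ?fine_ge0// -lte_fin fineK//.
by rewrite ge0_fin_numE// (lt_trans fne)// ltry.
Qed.

Lemma le_nncvg0 (f g : (\bar R)^nat) : (forall n, 0 <= f n) ->
  (\forall n \near \oo, f n <= g n) ->
  g n @[n --> \oo] --> 0 -> f n @[n --> \oo] --> 0.
Proof.
move=> f0 fg g0; apply: (squeeze_cvge _ _ g0); last exact: cvg_cst.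
by apply: filterS fg => n fgn; rewrite f0.
Qed.

Lemma nncvg0D (f g : (\bar R)^nat) :
  f n @[n --> \oo] --> 0 -> g n @[n --> \oo] --> 0 ->
  f n + g n @[n --> \oo] --> 0.
Proof. by move=> f0 g0; rewrite -[X in _ --> X](adde0 0); apply: cvgeD. Qed.

Lemma nncvg0Z (f : (\bar R)^nat) (c : R) :
  f n @[n --> \oo] --> 0 -> c%:E * f n @[n --> \oo] --> 0.
Proof. by move=> f0; rewrite -(mule0 c%:E); apply: cvgeZl. Qed.

Lemma le_add_nncvg0 (x c : \bar R) (f : (\bar R)^nat) : (forall n, 0 <= f n) ->
  f n @[n --> \oo] --> 0 -> (forall n, x <= c + f n) -> x <= c.
Proof.
move=> f0 /(nncvg0P f0) fc H; apply/lee_addgt0Pr => e e0.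
have [n _ /(_ n (leqnn n)) fe] := fc e e0.
by apply: le_trans (H n) _; apply: leeD2l; exact: ltW.
Qed.

(** If l is infinite, the second inequality forces a n = +oo as soon as e n is
    finite. *)
Lemma cvge_near_dist (a : (\bar R)^nat) (l : \bar R) (e : (\bar R)^nat) :
  (forall n, 0 <= a n) -> 0 <= l -> (forall n, 0 <= e n) ->
  (forall n, a n <= l + e n) -> (forall n, l <= a n + e n) ->
  e n @[n --> \oo] --> 0 -> a n @[n --> \oo] --> l.
Proof.
move=> a0 l0 e0 al la ec.
case: l l0 al la => [l l0 al la|_ al la|//].
  apply/fine_cvgP; have H d (d0 : (0 < d)%R) := (nncvg0P e0).1 ec d d0.
  have fin : \forall n \near \oo, a n \is a fin_num.
    apply: filterS (H 1%R ltr01) => n en; rewrite ge0_fin_numE//.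
    by apply: le_lt_trans (al n) _; rewrite lte_add_pinfty ?ltry// (lt_trans en)// ltry.
  split => //; apply/cvgrPdist_lt => d d0; move: fin (H d d0).
  apply: filterS2 => n an en; have {}al := al n; have {}la := la n.
  rewrite -(fineK an) in al la *; rewrite /= ltr_distlC.
  have en' : e n \is a fin_num by rewrite ge0_fin_numE// (lt_trans en)// ltry.
  move: en al la; rewrite -(fineK en') -!EFinD !lee_fin lte_fin => ? ? ?.
  by apply/andP; split; lra.
apply: cvg_near_cst; apply: filterS ((nncvg0P e0).1 ec 1%R ltr01) => n en.
have := la n; rewrite leye_eq => /eqP; case: (a n) (a0 n) => [r||]//.
by case: (e n) en (e0 n).
Qed.

End ereal_convergence.

Section strong_measurability.
Context {R : realType} {Z : lmodType R}.
Local Notation mu := (@lebesgue_measure R).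
Local Open Scope ereal_scope.
Implicit Types (E F : normed_subspace R Z) (u w : R -> Z).

Lemma simple_inP E (s : R -> Z) :
  simple_in E s <-> simple_map s /\ forall t, pos t -> carrier E (s t).
Proof.
split=> [[c f m]|[[f m] c]]; split => //; first by move=> t; rewrite in_posE; exact: c.
by move=> t t0; apply: c; rewrite in_posE.
Qed.

(** The seminorm M is continuous for the norm of E, so M (s - u) is almost
    everywhere the limit of the functions M (s - s_n), which take finitely
    many values. *)
Lemma strongly_measurable_dist E u (s : R -> Z) (M : Z -> \bar R) (C : R) :
  ext_seminorm M -> (forall z, M z <= C%:E * enorm E z) ->
  strongly_measurable E u -> simple_map s ->
  aemeasurable mu pos (fun t => M (s t - u t)%R).
Proof.
move=> hM MC [_ [sg [sgs sgc]]] ss.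
have M0 := esn_ge0 hM.
apply: (@ae_measurable_cvg _ _ _ mu pos (fun n t => M (s t - sg n t)%R)) => //.
- exact: measurable_pos.
- move=> n; have /simple_inP[sgn _] := sgs n.
  exact: (measurable_simple_map (fun p => M (p.1 - p.2)%R) (simple_map_pair ss sgn)).
apply: filterS sgc => t + t0; rewrite in_posE in t0 => /(_ t0) tc.
apply: (@cvge_near_dist _ _ _ (fun n => M (sg n t - u t)%R)) => //.
- move=> n; rewrite addeC (esnBC hM (sg n t)) addeC; exact: esn_trans.
- by move=> n; exact: esn_trans.
- apply: le_nncvg0 (nncvg0Z C tc) => //.
  by apply: nearW => n; exact: MC.
Qed.

Lemma strongly_measurable_esn E u (M : Z -> \bar R) (C : R) :
  ext_seminorm M -> (forall z, M z <= C%:E * enorm E z) ->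
  strongly_measurable E u -> aemeasurable mu pos (fun t => M (u t)).
Proof.
move=> hM MC mu_.
have s0 : simple_map (fun _ : R => 0%R : Z).
  split.
    by apply: sub_finite_set (finite_set1 (0%R : Z)) => _ [t _ <-].
  move=> z; rewrite /fiber; have [->|z0] := eqVneq z 0%R.
    by rewrite (_ : _ @^-1` _ = setT) ?setIT//; apply/seteqP; split.
  rewrite (_ : _ @^-1` _ = set0) ?setI0//; apply/seteqP; split => // t /= /eqP.
  by rewrite eq_sym (negbTE z0).
have [g mg H] := strongly_measurable_dist hM MC mu_ s0.
exists g => //; apply: filterS H => t /[apply] <-.
by rewrite sub0r (esnN hM).
Qed.

Lemma sub_strongly_measurable E F u : seminormed E -> seminormed F ->
  (forall z, enorm F z <= enorm E z) ->
  strongly_measurable E u -> strongly_measurable F u.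
Proof.
move=> hE hF FE [cu [s [ss sc]]].
have cEF z : carrier E z -> carrier F z.
  by move=> /hE.2 zE; apply/hF.2; exact: le_lt_trans zE.
split; first by move=> t /cu/cEF.
exists s; split.
  by move=> n; have [c f m] := ss n; split => // t /c/cEF.
apply: filterS sc => t + t0 => /(_ t0); apply: le_nncvg0.
  by move=> n; exact: esn_ge0 hF.1 _.
by apply: nearW => n; exact: FE.
Qed.

Lemma carrierZ E (r : R) z : seminormed E -> carrier E z -> carrier E (r *: z).
Proof.
move=> hE /hE.2 zE; apply/hE.2; rewrite (esnZ hE.1) lte_mul_pinfty//.
Qed.

Import HBNNSimple.

Lemma nnsfun_simple_map (g : {nnsfun R >-> R}) : simple_map g.
Proof.
split.
  have fg : finite_set (range g) by exact: fimfunP.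
  by apply: sub_finite_set fg => _ [t _ <-]; exists t.
by move=> y; apply: measurableI => //; exact: measurable_funPTI.
Qed.

(** The products of simple approximations of rho and u approximate rho u. *)
Lemma strongly_measurableZ E u (rho : R -> R) : seminormed E ->
  measurable_fun pos rho -> (forall t, pos t -> (0 <= rho t)%R) ->
  strongly_measurable E u -> strongly_measurable E (fun t => rho t *: u t).
Proof.
move=> hE mrho rho0 [cu [s [ss sc]]].
have mrho' : measurable_fun pos (EFin \o rho) by apply/measurable_EFinP.
pose r n : R -> R := (nnsfun_approx (@measurable_pos R) mrho' n).
have rc t : pos t -> r n t @[n --> \oo] --> rho t.
  move=> t0; have := cvg_nnsfun_approx (@measurable_pos R) mrho' _ t0.
  by move=> /(_ rho0) /fine_cvg.
split; first by move=> t t0; apply: carrierZ => //; exact: cu.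
exists (fun n t => r n t *: s n t); split.
  move=> n; have /simple_inP[ms cs] := ss n; apply/simple_inP; split.
    have mr : simple_map (r n) by exact: nnsfun_simple_map.
    exact: (simple_map_comp (fun p : R * Z => p.1 *: p.2) (simple_map_pair mr ms)).
  by move=> t t0; apply: carrierZ => //; exact: cs.
apply: filterS sc => t + t0 => /(_ t0) tc.
have pt : pos t by rewrite in_posE.
have N0 := esn_ge0 hE.1.
have rM : \forall n \near \oo, (`|r n t| <= rho t + 1)%R.
  move/cvgrPdist_lt : (rc t pt) => /(_ _ ltr01); apply: filterS => n.
  have := rho0 t pt; rewrite ltr_distlC => ? /andP[? ?].
  by rewrite ler_norml; apply/andP; split; lra.
apply: (@le_nncvg0 _ _ (fun n => (rho t + 1)%:E * enorm E (s n t - u t)%R +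
   `|r n t - rho t|%:E * enorm E (u t))) => //.
  apply: filterS rM => n rM.
  have -> : (r n t *: s n t - rho t *: u t = r n t *: (s n t - u t) + (r n t - rho t) *: u t)%R.
    by rewrite scalerBr scalerBl addrA subrK.
  apply: le_trans (esnD hE.1 _ _) _; rewrite !(esnZ hE.1); apply: leeD => //.
  by apply: lee_wpmul2r => //; rewrite lee_fin.
apply: nncvg0D; first exact: nncvg0Z.
have uf : enorm E (u t) \is a fin_num by rewrite ge0_fin_numE//; apply/hE.2/cu.
rewrite -(mul0e (enorm E (u t))); apply: cvgeZr => //.
apply: cvg_EFin; first exact: nearW.
rewrite /=; apply/cvgrPdist_lt => e e0.
move/cvgrPdist_lt : (rc t pt) => /(_ e e0); apply: filterS => n /=.
by rewrite sub0r normrN normr_id distrC.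
Qed.

End strong_measurability.

(** * Bochner integrability *)

Section bochner.
Context {R : realType} {Z : lmodType R}.
Local Notation mu := (@lebesgue_measure R).
Local Open Scope ereal_scope.
Implicit Types (E F : normed_subspace R Z) (u w : R -> Z).

(** The approximations of w are cut off where their norm exceeds twice that of
    w. Where w does not vanish this has no effect in the limit; where w
    vanishes, the cut-off function is already at distance 0 from w. Cutting off
    gives the bound 2 |w|, so dominated convergence applies. *)
Lemma bochner_approx E w : seminormed E ->
  (forall z, enorm E z = 0 -> z = 0%R) ->
  strongly_measurable E w -> \int[mu]_(t in pos) enorm E (w t) < +oo ->
  exists tau : nat -> R -> Z,
    (forall n, simple_in E (tau n) /\ simple_integrable (tau n)) /\
    (\int[mu]_(t in pos) enorm E (tau n t - w t)%R) @[n --> \oo] --> 0.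
Proof.
move=> hE defE sw intw; have N0 := esn_ge0 hE.1.
have N1 z : enorm E z <= 1%:E * enorm E z by rewrite mul1e.
have [cw [sg [sgs sgc]]] := sw.
have [G [mG G0 wG]] := ae_measurable_ge0 (mu := mu) (fun t _ => N0 (w t))
  (strongly_measurable_esn hE.1 N1 sw).
have intG : \int[mu]_(t in pos) G t < +oo.
  by rewrite -(ge0_eq_integral_ae _ _ _ wG)//; exact: measurable_pos.
(* the cut-off; G is a Borel version of the norm of w *)
pose b n t := enorm E (sg n t) <= 2%:E * G t.
have mG2 : measurable_fun pos (fun t => 2%:E * G t) by exact: measurable_funeM.
have msg n : simple_map (sg n) by have /simple_inP[] := sgs n.
have mb n : simple_map (b n).
  have ms := measurable_simple_map (enorm E) (msg n).
  have mT := measurable_lee (@measurable_pos R) ms mG2.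
  split; first exact: finite_finset.
  case; first by rewrite (_ : fiber _ _ = pos `&` [set t | enorm E (sg n t) <= 2%:E * G t]).
  rewrite (_ : fiber _ _ = pos `\` (pos `&` [set t | enorm E (sg n t) <= 2%:E * G t])).
    by apply: measurableD => //; exact: measurable_pos.
  apply/seteqP; split => t [t0].
    by rewrite /b /= => bf; split => // -[_ /=]; rewrite bf.
  by move=> /= H; split => //; apply/negbTE/negP => H'; exact: H.
pose tau n t := if b n t then sg n t else 0%R.
have mtau n : simple_map (tau n).
  exact: (simple_map_comp (fun p : bool * Z => if p.1 then p.2 else 0%R)
    (simple_map_pair (mb n) (msg n))).
have tauG n t : enorm E (tau n t) <= 2%:E * G t.
  rewrite /tau /b; case: ifP => // _; rewrite (esn0 hE.1).
  by rewrite mule_ge0.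
have stau n : simple_in E (tau n).
  apply/simple_inP; split => // t t0; rewrite /tau; case: ifP => _.
    by have /simple_inP[_] := sgs n; exact.
  by apply/hE.2; rewrite (esn0 hE.1).
have int2G : \int[mu]_(t in pos) (2%:E * G t) < +oo.
  rewrite ge0_integralZl//; first by rewrite lte_mul_pinfty// integral_ge0.
  exact: measurable_pos.
exists tau; split.
  move=> n; split => // z z0.
  have Nz : 0 < enorm E z.
    by rewrite lt_neqAle N0 andbT eq_sym; apply/eqP => /defE/eqP; rewrite (negbTE z0).
  have [/set0P[t [t0 tz]]|fz] := boolP (fiber (tau n) z != set0); last first.
    by move/negPn/eqP : fz => fz; rewrite -[X in mu X]/(fiber (tau n) z) fz measure0 ltry.
  have Nzoo : enorm E z < +oo.
    by apply/hE.2; rewrite -tz; have /simple_inP[_] := stau n; exact.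
  have Nzf : enorm E z \is a fin_num by rewrite ge0_fin_numE.
  rewrite -[X in mu X]/(fiber (tau n) z).
  have H : enorm E z * mu (fiber (tau n) z) < +oo.
    apply: le_lt_trans int2G; rewrite -(integral_cst mu)//; last exact: (mtau n).2.
    apply: (@le_trans _ _ (\int[mu]_(t in fiber (tau n) z) (2%:E * G t))).
      apply: ge0_le_lower_integral.
      - exact: (mtau n).2.
      - by move=> s _; exact: N0.
      - by move=> s [_ /= <-].
    apply: ge0_subset_integral => //.
    - exact: (mtau n).2.
    - exact: measurable_pos.
    - by move=> s _; rewrite mule_ge0.
    - by move=> s [].
  move: H; rewrite -(fineK Nzf); have : (0 < fine (enorm E z))%R.
    by rewrite fine_gt0// Nz.
  move: (fine _) => r r0; rewrite ltey => H; rewrite ltey; apply: contra H => /eqP ->.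
  by rewrite gt0_muley.
pose D n t := enorm E (tau n t - w t)%R.
have D0 n t : 0 <= D n t by exact: N0.
have mD n : aemeasurable mu pos (D n).
  exact: (strongly_measurable_dist hE.1 N1 sw (mtau n)).
have [D' HD'] := choice (fun n => ae_measurable_ge0 (mu := mu) (fun t _ => D0 n t) (mD n)).
have [mD' D'0 DD'] := all_and3 HD'.
have Dc : {ae mu, forall t, pos t -> D n t @[n --> \oo] --> 0}.
  apply: filterS2 sgc wG => t + + t0 => sc /(_ t0) wGt.
  have {}sc : enorm E (sg n t - w t)%R @[n --> \oo] --> 0.
    by apply: sc; rewrite -in_posE.
  apply: (@le_nncvg0 _ _ (fun n => enorm E (sg n t - w t)%R)) => //.
  have Goo : G t < +oo by rewrite -wGt; apply/hE.2/cw; rewrite -in_posE.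
  have [Gt0|Gt0] := eqVneq (G t) 0.
    apply: nearW => n; rewrite /D /tau; case: ifP => // _.
    by rewrite sub0r (esnN hE.1) wGt Gt0.
  have Gtf : G t \is a fin_num by rewrite ge0_fin_numE.
  have Gp : (0 < fine (G t))%R by rewrite fine_gt0// Goo lt_neqAle eq_sym Gt0 G0.
  apply: filterS ((nncvg0P _).1 sc _ Gp) => // n ns.
  rewrite /D /tau ifT// /b.
  have := esnD hE.1 (sg n t - w t)%R (w t); rewrite subrK wGt => /le_trans; apply.
  rewrite -[X in 2%:E * X](fineK Gtf) -EFinM mulr2n mulrDl mul1r EFinD fineK//.
  by rewrite leeD2r// ltW// -(fineK Gtf).
have ig : mu.-integrable pos (fun t => 3%:E * G t).
  apply: integrableZl; first exact: measurable_pos.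
  apply/integrableP; split => //.
  by rewrite (eq_integral G)// => t _; rewrite gee0_abs.
have := @dominated_convergence _ _ _ mu pos (@measurable_pos R) D' (cst 0)
  (fun t => 3%:E * G t) mD' _ _ ig _.
case.
- exact: measurable_cst.
- apply: filterS2 (ae_foralln DD') Dc => t Dt + t0 => /(_ t0).
  by apply: cvg_trans; apply: near_eq_cvg; apply: nearW => n; rewrite Dt.
- apply: filterS2 (ae_foralln DD') wG => t Dt wGt n t0.
  rewrite -Dt// gee0_abs// /D (le_trans (esnB hE.1 _ _))// wGt//.
  rewrite (_ : 3%:E = 2%:E + 1%:E)//; last by rewrite -EFinD; congr EFin; ring.
  by rewrite ge0_muleDl// mul1e leeD2r.
move=> _ + _; apply: cvg_trans; apply: near_eq_cvg; apply: nearW => n /=.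
apply: ge0_eq_integral_ae => //; first exact: measurable_pos.
by apply: filterS (DD' n) => t /[apply] <-; rewrite sube0 gee0_abs.
Qed.

End bochner.

(** * Consequences of a J-representation *)

Section representations.
Context {R : realType} {Z : lmodType R}.
Local Notation mu := (@lebesgue_measure R).
Local Open Scope ereal_scope.
Implicit Types (E F : normed_subspace R Z) (u w : R -> Z).

Definition seq_complete E := forall x : nat -> Z, (forall n, carrier E (x n)) ->
  (forall e : R, (0 < e)%R -> exists N, forall m n, (N <= m)%N -> (N <= n)%N ->
     enorm E (x m - x n)%R < e%:E) ->
  exists2 l, carrier E l & enorm E (x n - l)%R @[n --> \oo] --> 0.

Lemma seq_complete_embedded (X : completeNormedModType R) (i : {linear X -> Z}) :
  injective i -> seq_complete (embedded i).
Proof.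
move=> ii x cx xc.
have cx' n : exists y, i y = x n by have [y _ yx] := cx n; exists y.
have [y yE] := choice cx'.
have yc : cvgn y.
  apply/cauchy_cvgP/cauchyP => e e0; have [N HN] := xc e e0.
  exists (y N), N => // n /= Nn; rewrite -ball_normE /=.
  by have := HN N n (leqnn N) Nn; rewrite -!yE -linearB enorm_embedded// lte_fin.
exists (i (limn y)); first by exists (limn y).
apply/(nncvg0P (fun n => esn_ge0 (seminormed_embedded i).1 _)) => e e0.
move/cvgrPdist_lt : (yc) => /(_ e e0); apply: filterS => n.
by rewrite -yE -linearB enorm_embedded// lte_fin distrC.
Qed.

Lemma carrier_simple_integral E (s : R -> Z) : seminormed E -> simple_in E s ->
  carrier E (simple_integral s).
Proof.
move=> hE [cs fs _]; rewrite /simple_integral fsbig_finite//= big_seq.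
elim/big_ind : _ => [|x y|z].
- by apply/hE.2; rewrite (esn0 hE.1).
- move=> /hE.2 xE /hE.2 yE; apply/hE.2; apply: le_lt_trans (esnD hE.1 _ _) _.
  exact: lte_add_pinfty.
- rewrite in_fset_set// inE => -[t t0 <-]; apply: carrierZ => //.
  by apply: cs; rewrite -in_posE.
Qed.

Lemma measurable_inv_pos : measurable_fun (@pos R) (fun t => t^-1)%R.
Proof.
apply: open_continuous_measurable_fun; first exact: interval_open.
move=> t; rewrite inE in_posE => t0; apply: inv_continuous.
by rewrite gt_eqF.
Qed.

Section couple.
Variables (E F : normed_subspace R Z).
Hypotheses (hE : seminormed E) (hF : seminormed F).
Let hS := seminormed_sum hE hF.

Let le1E (G : normed_subspace R Z) z : enorm G z <= 1%:E * enorm G z.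
Proof. by rewrite mul1e. Qed.

Lemma sum_enorm_le0 z : enorm (sum_space E F) z <= enorm E z.
Proof. by rewrite sum_enormE; exact: Kfun_le0. Qed.

(** Since K(., t) is equivalent to the norm of the sum, it may be taken inside
    the Bochner integral, where the J-functional bounds it at each s. *)
Lemma Kfun_representation_le f u (t : R) : (0 < t)%R -> J_representation E F f u ->
  Kfun E F f t <=
    \int[mu]_(s in pos) ((s^-1 * Num.min 1 (t / s))%:E * Jfun E F (u s) s).
Proof.
move=> t0 [su [cf sw [s [ss sint slim]]]].
pose C := Num.max 1%R t.
have hK := Kfun_seminorm hE hF t0.
have C0 : (0 < C)%R by rewrite lt_max ltr01.
have KC z : Kfun E F z t <= C%:E * enorm (sum_space E F) z.
  rewrite sum_enormE -[C]divr1.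
  apply: le_trans (Kfun_scale hE hF _ ltr01 _); last by rewrite le_max lexx.
  by apply: Kfun_mono => //; rewrite le_max lexx orbT.
have KU : \int[mu]_(r in pos) Kfun E F (r^-1 *: u r) t <=
    \int[mu]_(s in pos) ((s^-1 * Num.min 1 (t / s))%:E * Jfun E F (u s) s).
  apply: ge0_le_lower_integral; first exact: measurable_pos.
    by move=> r _; exact: esn_ge0 hK _.
  move=> r; rewrite in_posE => r0.
  have r1 : (0 <= r^-1)%R by rewrite invr_ge0 ltW.
  rewrite (esnZ hK) ger0_norm// EFinM -muleA.
  apply: lee_wpmul2l; [by rewrite lee_fin|exact: Kfun_leJ].
apply: le_trans KU.
pose e n := C%:E * enorm (sum_space E F) (simple_integral (s n) - f)%R +
  C%:E * \int[mu]_(t in pos) enorm (sum_space E F) (s n t - t^-1 *: u t)%R.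
have S0 := esn_ge0 hS.1.
apply: (@le_add_nncvg0 _ _ _ e).
- move=> n; have C0' : 0 <= C%:E by rewrite lee_fin ltW.
  by rewrite /e adde_ge0// mule_ge0// integral_ge0.
- by apply: nncvg0D; exact: nncvg0Z.
move=> n; have [sn ni] := ss n; have /simple_inP[mn cn] := sn.
have sd := strongly_measurable_dist hK KC sw mn.
have su' := strongly_measurable_esn hK KC sw.
have H1 : Kfun E F f t <= Kfun E F (simple_integral (s n) - f)%R t +
    Kfun E F (simple_integral (s n)) t.
  rewrite (esnBC hK); have := esnD hK (f - simple_integral (s n))%R (simple_integral (s n)).
  by rewrite subrK.
have H2 := esn_simple_integral_le hK mn ni.
have H3 : \int[mu]_(r in pos) Kfun E F (s n r) t <=
  \int[mu]_(r in pos) Kfun E F (s n r - r^-1 *: u r)%R t +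
  \int[mu]_(r in pos) Kfun E F (r^-1 *: u r) t.
  apply: ge0_integral_leD => //; first exact: measurable_pos.
  - by move=> r _; exact: esn_ge0 hK _.
  - by move=> r _; exact: esn_ge0 hK _.
  - by move=> r _; exact: esn_ge0 hK _.
  - apply: aeW => r _; rewrite -[X in Kfun E F X _ <= _](subrK (r^-1 *: u r)%R).
    exact: (esnD hK).
have H4 : \int[mu]_(r in pos) Kfun E F (s n r - r^-1 *: u r)%R t <=
  C%:E * \int[mu]_(t in pos) enorm (sum_space E F) (s n t - t^-1 *: u t)%R.
  have [g [mg g0 sg]] := ae_measurable_ge0 (mu := mu) (fun r _ => S0 (s n r - r^-1 *: u r)%R)
    (strongly_measurable_dist hS.1 (@le1E _) sw mn).
  rewrite (ge0_eq_integral_ae _ _ _ sg)//; last exact: measurable_pos.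
  rewrite -ge0_integralZl//; last 2 first.
  - exact: measurable_pos.
  - by rewrite lee_fin ltW.
  apply: ge0_le_integral_ae.
  - exact: measurable_pos.
  - by move=> r _; exact: esn_ge0 hK _.
  - by move=> r _; rewrite mule_ge0// lee_fin ltW.
  - by move: sg; apply: filterS => r sgr r0; rewrite -(sgr r0).
apply: (le_trans H1); rewrite /e addeCA.
apply: leeD; first exact: KC.
rewrite addeC; apply: (le_trans H2); apply: (le_trans H3).
exact: leeD.
Qed.

(** If the integral of u converges absolutely in the first space, then it has
    simple approximations whose integrals form a Cauchy sequence there. The
    limit of that sequence in the first space and the Bochner integral f,
    computed in the sum, must coincide because the norm of the sum separates
    points. *)
Lemma representation_in_left f u :
  (forall z, enorm (sum_space E F) z = 0 -> z = 0%R) -> seq_complete E ->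
  J_representation E F f u ->
  \int[mu]_(s in pos) ((s^-1)%:E * enorm E (u s)) < +oo ->
  carrier E f /\ enorm E f <= \int[mu]_(s in pos) ((s^-1)%:E * enorm E (u s)).
Proof.
move=> defS compE [su [cf swS [s [ss sint slim]]]] intu.
have defE z : enorm E z = 0 -> z = 0%R.
  move=> z0; apply: defS; apply/eqP.
  by rewrite eq_le (esn_ge0 hS.1) andbT -z0 sum_enorm_le0.
pose w r := (r^-1 *: u r)%R.
have swE : strongly_measurable E w.
  apply: strongly_measurableZ => //.
  - exact: measurable_inv_pos.
  - by move=> r; rewrite in_posE => r0; rewrite invr_ge0 ltW.
  - apply: sub_strongly_measurable su => //; first exact: seminormed_inter.
    by move=> z; rewrite /= le_max lexx.
have wE : \int[mu]_(r in pos) enorm E (w r) = \int[mu]_(s in pos) ((s^-1)%:E * enorm E (u s)).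
  apply: eq_integral => r; rewrite inE in_posE => r0.
  by rewrite (esnZ hE.1) ger0_norm// invr_ge0 ltW.
rewrite -wE in intu *.
have [tau [taus tauc]] := bochner_approx hE defE swE intu.
have E0 := esn_ge0 hE.1; have S0 := esn_ge0 hS.1.
pose I n := simple_integral (tau n).
pose d n := \int[mu]_(r in pos) enorm E (tau n r - w r)%R.
have d0 n : 0 <= d n by apply: integral_ge0.
have mt n : simple_map (tau n) by have [/simple_inP[]] := taus n.
have aed n : aemeasurable mu pos (fun r => enorm E (tau n r - w r)%R).
  exact: strongly_measurable_dist hE.1 (@le1E _) swE (mt n).
have aew : aemeasurable mu pos (fun r => enorm E (w r)).
  exact: strongly_measurable_esn hE.1 (@le1E _) swE.
have In n : enorm E (I n) <= \int[mu]_(r in pos) enorm E (w r) + d n.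
  apply: le_trans (esn_simple_integral_le hE.1 (mt n) (taus n).2) _.
  apply: ge0_integral_leD => //; first exact: measurable_pos.
  apply: aeW => r _; rewrite addeC.
  by rewrite -[X in enorm E X <= _](subrK (w r)); exact: esnD hE.1 _ _.
have Imn m n : enorm E (I m - I n)%R <= d m + d n.
  apply: le_trans (esn_simple_integralB hE.1 (mt m) (mt n) (taus m).2 (taus n).2) _.
  apply: ge0_integral_leD => //; first exact: measurable_pos.
  apply: aeW => r _; rewrite (esnBC hE.1 (tau n r)); exact: esn_trans hE.1 _ _ _.
have Ic e : (0 < e)%R -> exists N, forall m n, (N <= m)%N -> (N <= n)%N ->
     enorm E (I m - I n)%R < e%:E.
  move=> e0; have e20 : (0 < e / 2)%R by rewrite divr_gt0.
  have [N _ HN] := (nncvg0P d0).1 tauc _ e20; exists N => m n Nm Nn.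
  apply: le_lt_trans (Imn m n) _; rewrite [e]splitr EFinD.
  by apply: lteD; exact: HN.
have cI n : carrier E (I n) by apply: carrier_simple_integral => //; exact: (taus n).1.
have [l cl lI] := compE I cI Ic.
pose p n := enorm (sum_space E F) (simple_integral (s n) - f)%R.
pose q n := \int[mu]_(t in pos) enorm (sum_space E F) (s n t - t^-1 *: u t)%R.
have fl : f = l.
  apply/esym/eqP; rewrite -subr_eq0; apply/eqP/defS/eqP; rewrite eq_le S0 andbT.
  apply: (@le_add_nncvg0 _ _ _ (fun n => enorm E (I n - l)%R + ((d n + q n) + p n))).
  - move=> n; have q0 : 0 <= q n by apply: integral_ge0.
    have p0 : 0 <= p n by exact: S0.
    apply: adde_ge0; first exact: E0.
    by rewrite adde_ge0// adde_ge0.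
  - by apply: nncvg0D => //; apply: nncvg0D => //; exact: nncvg0D.
  move=> n; rewrite add0e.
  have [sn ni] := ss n; have /simple_inP[mn cn] := sn.
  have h1 : enorm (sum_space E F) (l - f)%R <= enorm (sum_space E F) (l - I n)%R + 
      (enorm (sum_space E F) (I n - simple_integral (s n))%R + p n).
    apply: le_trans (esn_trans hS.1 _ (I n) _) _; apply: leeD2l.
    exact: esn_trans hS.1 _ _ _.
  apply: (le_trans h1); apply: leeD.
    by rewrite (esnBC hS.1); exact: sum_enorm_le0.
  apply: leeD => //.
  apply: le_trans (esn_simple_integralB hS.1 (mt n) mn (taus n).2 ni) _.
  apply: ge0_integral_leD => //.
  - exact: measurable_pos.
  - exact: strongly_measurable_dist hS.1 (@le1E _) swS mn.
  - apply: aeW => r _; apply: le_trans (esn_trans hS.1 _ (w r) _) _.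
    apply: leeD; first exact: sum_enorm_le0.
    by rewrite (esnBC hS.1).
split; first by rewrite fl.
apply: (@le_add_nncvg0 _ _ _ (fun n => d n + enorm E (I n - l)%R)).
- by move=> n; rewrite adde_ge0.
- exact: nncvg0D.
move=> n; rewrite addeA; apply: le_trans (leeD (In n) (lexx _)).
rewrite fl (esnBC hE.1); have := esnD hE.1 (I n) (l - I n)%R.
by rewrite addrCA subrr addr0.
Qed.

End couple.
End representations.

(** * A Hardy inequality for slowly varying weights *)

Section weight.
Context {R : realType}.
Local Notation mu := (@lebesgue_measure R).
Local Open Scope ereal_scope.
Variables (A : R -> R) (h : R -> \bar R) (C : R).
Hypothesis mh : measurable_fun setT h.
Hypothesis h0 : forall x, 0 <= h x.
Hypothesis hA : forall x y, (0 < x)%R -> (x <= y)%R ->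
  \int[mu]_(t in `]x, y]) h t = (A x - A y)%:E.
Hypothesis A0 : forall x, (0 < x)%R -> (0 <= A x)%R.
Hypothesis C0 : (0 <= C)%R.
Hypothesis AC : forall (s : R) k, (0 < s)%R ->
  (A (s / 4 ^+ k) <= C * 2 ^+ k * A s)%R.

Let g s t := (Num.min 1 (t / s))%:E * h t.

Let mg s D : measurable D -> measurable_fun D (g s).
Proof.
move=> mD; apply: emeasurable_funM; last exact: measurable_funTS.
apply/measurable_EFinP; apply: measurable_minr => //.
by apply: measurable_funM.
Qed.

Let g0 s t : (0 < s)%R -> (0 < t)%R -> 0 <= g s t.
Proof.
move=> s0 t0; rewrite /g mule_ge0// lee_fin le_min ler01/=.
by rewrite divr_ge0// ltW.
Qed.

Let g_right s y : (0 < s)%R -> (s <= y)%R -> \int[mu]_(t in `]s, y]) g s t <= (A s)%:E.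
Proof.
move=> s0 sy; apply: (@le_trans _ _ (\int[mu]_(t in `]s, y]) h t)).
  apply: ge0_le_lower_integral => //.
    by move=> t; rewrite /= in_itv/= => /andP[st _]; apply: g0 => //; exact: lt_trans st.
  move=> t; rewrite /= in_itv/= => /andP[st _]; rewrite /g.
  by rewrite min_l ?mul1e// ler_pdivlMr// mul1r ltW.
by rewrite hA// lee_fin lerBlDr lerDl A0// (lt_le_trans s0).
Qed.

Let g_block s x y : (0 < s)%R -> (0 < x)%R -> (x <= y)%R -> (y <= s)%R ->
  \int[mu]_(t in `]x, y]) g s t <= (y / s * A x)%:E.
Proof.
move=> s0 x0 xy ys; have y0 := lt_le_trans x0 xy.
have ys0 : (0 < y / s)%R by rewrite divr_gt0.
apply: (@le_trans _ _ (\int[mu]_(t in `]x, y]) ((y / s)%:E * h t))).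
  apply: ge0_le_lower_integral => //.
    by move=> t; rewrite /= in_itv/= => /andP[xt _]; apply: g0 => //; exact: lt_trans xt.
  move=> t; rewrite /= in_itv/= => /andP[xt ty]; rewrite /g.
  apply: lee_wpmul2r => //; rewrite lee_fin ge_min; apply/orP; right.
  by rewrite ler_pM2r ?invr_gt0.
apply: le_trans (ge0_integral_leZ _ _ _ _) _ => //.
rewrite hA// -EFinM lee_fin; apply: ler_wpM2l; first exact: ltW.
by rewrite lerBlDr lerDl A0.
Qed.

(** The constant 4 C (1 - 2^-n) is the partial sum of the geometric series of
    the contributions 2 C 2^-k of the blocks. *)
Let g_left s n : (0 < s)%R ->
  \int[mu]_(t in `](s / 4 ^+ n)%R, s]) g s t <= (4 * C * (1 - 2 ^- n) * A s)%:E.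
Proof.
move=> s0; elim: n => [|n IH].
  by rewrite expr0 divr1 set_itvoc0 integral_set0 invr1 subrr mulr0 mul0r.
have p4 k : (0 < 4 ^+ k :> R)%R by rewrite exprn_gt0.
have p2 k : (0 < 2 ^+ k :> R)%R by rewrite exprn_gt0.
have le1 : (s / 4 ^+ n.+1 <= s / 4 ^+ n)%R.
  rewrite ler_pM2l// lef_pV2 ?posrE// exprS ler_peMl ?ler1n// (ltW (p4 n)).
have le2 : (s / 4 ^+ n <= s)%R.
  by rewrite ler_pdivrMr// ler_peMr ?(ltW s0)// exprn_ege1// ler1n.
have x0 : (0 < s / 4 ^+ n.+1)%R by rewrite divr_gt0.
rewrite (@itv_bndbnd_setU _ _ _ (BRight (s / 4 ^+ n)%R)) ?bnd_simp//.
rewrite ge0_integral_setU//; first last.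
- rewrite disj_set2E; apply/eqP; rewrite -subset0 => t [/=]; rewrite !in_itv/=.
  by move=> /andP[_ /le_lt_trans H] /andP[/H]; rewrite ltxx.
- move=> t Ht; apply: g0 => //; apply: lt_trans x0 _.
  case: Ht => /=; rewrite in_itv/= => /andP[]// + _; exact: le_lt_trans.
- by apply: mg; exact: measurableU.
apply: le_trans (leeD (g_block s0 x0 le1 le2) IH) _.
rewrite -EFinD lee_fin.
have := AC n.+1 s0.
have -> : (s / 4 ^+ n / s = 4 ^- n)%R by rewrite mulrAC divff ?mul1r// gt_eqF.
have -> : (4 ^- n = 2 ^- n * 2 ^- n :> R)%R.
  by rewrite -invfM -exprMn -natrM.
have -> : (2 ^- n.+1 = 2 ^- n / 2 :> R)%R by rewrite exprS invfM mulrC.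
move=> H.
have e1 : (2 ^- n * 2 ^+ n = 1 :> R)%R by rewrite mulVf// gt_eqF.
set i := (2 ^- n)%R in e1 *.
have i0 : (0 <= i)%R by rewrite /i invr_ge0 ltW.
have : (i * i * A (s / 4 ^+ n.+1) <= i * i * (C * 2 ^+ n.+1 * A s))%R.
  by rewrite ler_wpM2l// mulr_ge0.
rewrite [(2 ^+ n.+1)%R]exprS.
have -> : (i * i * (C * (2 * 2 ^+ n) * A s) = 2 * C * i * A s * (i * 2 ^+ n))%R by ring.
rewrite e1 mulr1 => H1.
apply: le_trans (lerD H1 (lexx _)) _.
rewrite le_eqVlt; apply/orP; left; apply/eqP; by field.
Qed.

(** Beyond s the minimum is 1 and the integral of the density is at most A s.
    Below s, on the block (s / 4^(k+1), s / 4^k] the minimum is at most 4^-k,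
    while slow variation bounds the mass of the block by C 2^(k+1) A s; the
    resulting series is geometric. *)
Lemma weight_bound s : (0 < s)%R ->
  \int[mu]_(t in pos) ((Num.min 1 (t / s))%:E * h t) <= ((4 * C + 1) * A s)%:E.
Proof.
move=> s0; pose F n := `](s / 4 ^+ n)%R, (s + n%:R)%R]%classic.
have p4 k : (0 < 4 ^+ k :> R)%R by rewrite exprn_gt0.
have F0 n t : F n t -> (0 < t)%R.
  by rewrite /F/= in_itv/= => /andP[+ _]; apply: lt_trans; rewrite divr_gt0.
have posF : pos = \bigcup_n F n.
  apply/seteqP; split => [t|t [n _ /F0]]; rewrite in_posE// => t0.
  pose n := maxn (Num.bound (s / t)) (Num.bound t).
  have n1 : (s / t < n%:R)%R.
    by apply: lt_le_trans (archi_boundP (divr_ge0 (ltW s0) (ltW t0))) _; rewrite ler_nat leq_maxl.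
  have n2 : (t <= n%:R)%R.
    by apply/ltW/(lt_le_trans (archi_boundP (ltW t0))); rewrite ler_nat leq_maxr.
  exists n => //; rewrite /F /= in_itv/=; apply/andP; split.
    rewrite ltr_pdivrMr// mulrC -ltr_pdivrMr//; apply: lt_trans n1 _.
    by rewrite -natrX ltr_nat ltn_expl.
  by rewrite (le_trans n2)// lerDr ltW.
have ndF : {homo F : n m / (n <= m)%N >-> (n <= m)%O}.
  move=> n m nm; apply/subsetPset => t; rewrite /F /= !in_itv/= => /andP[xt ty].
  apply/andP; split; last by rewrite (le_trans ty)// lerD2l ler_nat.
  apply: le_lt_trans xt; rewrite ler_pM2l// lef_pV2 ?posrE//.
  by rewrite ler_weXn2l// ler1n.
rewrite posF; have H : \int[mu]_(x in F i) g s x @[i --> \oo] -->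
    \int[mu]_(x in \bigcup_i F i) g s x.
  apply: ge0_nondecreasing_set_cvg_integral => [//|n|n|n t /F0 t0].
  - exact: measurable_itv.
  - by apply: mg; exact: measurable_itv.
  - exact: g0.
rewrite -(cvg_lim _ H)//; apply: lime_le.
  by apply/cvg_ex; exists (\int[mu]_(x in \bigcup_i F i) g s x).
apply: nearW => n.
have le2 : (s / 4 ^+ n <= s)%R.
  by rewrite ler_pdivrMr// ler_peMr ?(ltW s0)// exprn_ege1// ler1n.
have sn : (s <= s + n%:R)%R by rewrite lerDl.
rewrite /F (@itv_bndbnd_setU _ _ _ (BRight s)) ?bnd_simp//.
rewrite ge0_integral_setU//; first last.
- rewrite disj_set2E; apply/eqP; rewrite -subset0 => t [/=]; rewrite !in_itv/=.
  by move=> /andP[_ /le_lt_trans K] /andP[/K]; rewrite ltxx.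
- move=> t Ht; apply: g0 => //; apply: (F0 n); move: Ht; rewrite /F.
  by rewrite -itv_bndbnd_setU ?bnd_simp.
- by apply: mg; exact: measurableU.
apply: le_trans (leeD (g_left n s0) (g_right s0 sn)) _.
rewrite -EFinD lee_fin (_ : (4 * C + 1) * A s = 4 * C * A s + A s)%R; last by ring.
rewrite lerD2r.
by rewrite ler_wpM2r ?A0// ler_piMr ?mulr_ge0.
Qed.

End weight.

Section tonelli.
Context {R : realType}.
Local Notation mu := (@lebesgue_measure R).
Local Open Scope ereal_scope.

(** After exchanging the two integrals with Tonelli's theorem, the hypothesis
    bounds the inner one. *)
Lemma weighted_hardy (h j : R -> \bar R) (A : R -> R) (D : R) :
  measurable_fun pos h -> (forall t, 0 <= h t) ->
  measurable_fun pos j -> (forall s, 0 <= j s) ->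
  (0 < D)%R -> (forall s, (0 < s)%R -> (0 <= A s)%R) ->
  (forall s, (0 < s)%R ->
    \int[mu]_(t in pos) ((Num.min 1 (t / s))%:E * h t) <= (D * A s)%:E) ->
  \int[mu]_(t in pos)
    (h t * \int[mu]_(s in pos) ((s^-1 * Num.min 1 (t / s))%:E * j s)) <=
  D%:E * \int[mu]_(s in pos) ((s^-1 * A s)%:E * j s).
Proof.
move=> mh h0 mj j0 D0 A0 hA.
have mpos := @measurable_pos R.
pose iv : R -> R := (fun s => s^-1)%R \_ pos.
have miv : measurable_fun setT iv.
  by apply/(measurable_restrictT _ mpos); exact: measurable_inv_pos.
pose H := h \_ pos; pose J := j \_ pos.
have mH : measurable_fun setT H by apply/(measurable_restrictT _ mpos).
have mJ : measurable_fun setT J by apply/(measurable_restrictT _ mpos).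
have H0 t : 0 <= H t by rewrite /H patchE; case: ifP.
have J0 t : 0 <= J t by rewrite /J patchE; case: ifP.
(* The maximum with 0 makes the kernel non-negative on the whole plane. *)
pose k (p : R * R) : \bar R :=
  H p.1 * ((iv p.2 * Num.max 0 (Num.min 1 (p.1 * iv p.2)))%:E * J p.2).
have iv0 s : (0 <= iv s)%R.
  by rewrite /iv patchE; case: ifPn => //; rewrite inE in_posE invr_ge0 => /ltW.
have k0 p : 0 <= k p.
  by rewrite /k mule_ge0// mule_ge0// lee_fin mulr_ge0// le_max lexx.
have mk : measurable_fun setT k.
  apply: emeasurable_funM.
    by apply: (measurableT_comp mH); exact: measurable_fst.
  apply: emeasurable_funM; last first.
    by apply: (measurableT_comp mJ); exact: measurable_snd.
  apply/measurable_EFinP; apply: measurable_funM.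
    by apply: (measurableT_comp miv); exact: measurable_snd.
  apply: measurable_maxr => //; apply: measurable_minr => //.
  apply: measurable_funM; first exact: measurable_fst.
  by apply: (measurableT_comp miv); exact: measurable_snd.
have kE t s : (0 < t)%R -> (0 < s)%R ->
    k (t, s) = h t * ((s^-1 * Num.min 1 (t / s))%:E * j s).
  move=> t0 s0; rewrite /k /H /J /iv /= !patchE !mem_set ?in_posE//.
  by rewrite max_r// le_min ler01 divr_ge0// ltW.
have kl t s : t \notin pos -> k (t, s) = 0.
  by move=> tp; rewrite /k /H /= patchE (negbTE tp) mul0e.
have kr t s : s \notin pos -> k (t, s) = 0.
  by move=> sp; rewrite /k /J /= patchE (negbTE sp) !mule0.
clearbody k; clear H mH H0 J mJ J0 iv miv iv0.
have FT := @fubini_tonelli _ _ _ _ R mu mu k mk k0.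
have L : \int[mu]_(t in pos)
    (h t * \int[mu]_(s in pos) ((s^-1 * Num.min 1 (t / s))%:E * j s)) =
    \int[mu]_t \int[mu]_s k (t, s).
  rewrite integral_mkcond; apply: eq_integral => t _; rewrite patchE.
  case: ifPn => [|tp]; last first.
    by apply/esym/integral0_eq => s _; exact: kl.
  rewrite inE in_posE => t0.
  have mker : measurable_fun pos (fun s => (s^-1 * Num.min 1 (t / s))%:E * j s).
    apply: emeasurable_funM; last exact: mj.
    apply/measurable_EFinP; apply: measurable_funM; first exact: measurable_inv_pos.
    apply: measurable_minr; first exact: measurable_cst.
    apply: measurable_funM; first exact: measurable_cst.
    exact: measurable_inv_pos.
  have ker0 s : pos s -> 0 <= (s^-1 * Num.min 1 (t / s))%:E * j s.
    rewrite in_posE => s0; apply: mule_ge0 => //.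
    by rewrite lee_fin mulr_ge0 ?invr_ge0 ?(ltW s0)// le_min ler01 divr_ge0 ?(ltW s0) ?(ltW t0).
  rewrite -(ge0_integralZl mu mpos mker ker0 (h0 t)).
  rewrite integral_mkcond; apply: eq_integral => s _; rewrite patchE.
  case: ifPn => [|sp]; last by rewrite kr.
  by rewrite inE in_posE => s0; rewrite kE.
rewrite L FT.
apply: (@le_trans _ _ (\int[mu]_(s in pos) (D%:E * ((s^-1 * A s)%:E * j s)))); last first.
  apply: ge0_integral_leZ => // s; rewrite in_posE => s0.
  by rewrite mule_ge0// lee_fin mulr_ge0 ?A0// invr_ge0 ltW.
rewrite [leRHS]integral_mkcond.
apply: ge0_le_lower_integral => //; first by move=> s _; apply: integral_ge0.
move=> s _; rewrite patchE; case: ifPn => [|sp]; last first.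
  by rewrite (_ : integral _ _ _ = 0)//; apply: integral0_eq => t _; exact: kr.
rewrite inE in_posE => s0.
have -> : \int[mu]_t k (t, s) =
    \int[mu]_(t in pos) ((s^-1%:E * j s) * ((Num.min 1 (t / s))%:E * h t)).
  rewrite [RHS]integral_mkcond; apply: eq_integral => t _; rewrite patchE.
  case: ifPn => [|tp]; last by rewrite kl.
  rewrite inE in_posE => t0; rewrite kE// EFinM.
  by rewrite [RHS]muleACA [RHS]muleA [LHS]muleC.
have sj0 : 0 <= (s^-1)%:E * j s by rewrite mule_ge0// lee_fin invr_ge0 ltW.
have mker : measurable_fun pos (fun t => (Num.min 1 (t / s))%:E * h t).
  apply: emeasurable_funM; last exact: mh.
  apply/measurable_EFinP; apply: measurable_minr; first exact: measurable_cst.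
  apply: measurable_funM; [exact: measurable_id|exact: measurable_cst].
have ker0 t : pos t -> 0 <= (Num.min 1 (t / s))%:E * h t.
  rewrite in_posE => t0; apply: mule_ge0 => //.
  by rewrite lee_fin le_min ler01 divr_ge0 ?(ltW s0) ?(ltW t0).
rewrite (ge0_integralZl mu mpos mker ker0 sj0).
apply: le_trans (lee_wpmul2l sj0 (hA s s0)) _.
by rewrite !EFinM muleC -muleA lee_wpmul2l ?lee_fin ?(ltW D0)// muleCA muleA.
Qed.
End tonelli.

(** * Slowly varying functions *)

Section slowly_varying.
Context {R : realType}.
Implicit Types (a b : R -> R).

(** The definition is used with exponent 1/2: multiplied by the square root, b
    is equivalent to a non-decreasing function, and the square root of 4^k is
    2^k. *)
Lemma slowly_varying_growth b : slowly_varying b ->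
  exists2 C : R, 0 < C & forall s k, 0 < s -> b (s / 4 ^+ k) <= C * 2 ^+ k * b s.
Proof.
move=> [b0 _ /(_ 2^-1)[|[phi [phi0 phim [c1 [c2 [c10 c20 H]]]]] _]]; first by rewrite invr_gt0.
exists (c1 * c2); first exact: mulr_gt0.
move=> s k s0; have p4 : 0 < 4 ^+ k :> R by rewrite exprn_gt0.
have p2 : 0 < 2 ^+ k :> R by rewrite exprn_gt0.
have x0 : 0 < s / 4 ^+ k by rewrite divr_gt0.
have xs : s / 4 ^+ k <= s by rewrite ler_pdivrMr// ler_peMr ?(ltW s0)// exprn_ege1// ler1n.
have [H1 _] := H _ x0; have [_ H2] := H _ s0; have H3 := phim _ _ x0 xs.
have r0 : 0 < s `^ 2^-1 by rewrite powR_gt0.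
have E : s `^ 2^-1 = 2 ^+ k * (s / 4 ^+ k) `^ 2^-1.
  have -> : 2 ^+ k = (4 ^+ k) `^ 2^-1 :> R.
    have -> : 4 ^+ k = (2 ^+ k) `^ 2 :> R.
      by rewrite powR_mulrn ?(ltW p2)// -exprM mulnC exprM expr2 -natrM.
    by rewrite -powRrM mulfV ?powRr1// ltW.
  by rewrite -powRM ?(ltW p4) ?(ltW x0)// mulrC divfK// gt_eqF.
rewrite -(ler_pM2l r0) {1}E.
have H4 : (s / 4 ^+ k) `^ 2^-1 * b (s / 4 ^+ k) <= c1 * (c2 * (s `^ 2^-1 * b s)).
  by apply: le_trans H1 _; rewrite ler_pM2l//; exact: le_trans H3 H2.
rewrite -[leLHS]mulrA; apply: le_trans (ler_wpM2l (ltW p2) H4) _.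
by rewrite le_eqVlt; apply/orP; left; apply/eqP; ring.
Qed.

(** From s, move to s / 2, s / 4, ... and stop as soon as a has doubled. By
    the halving bound the last step multiplies a by at most C, so the total
    increase is controlled from both sides. *)
Lemma jump_sequence a (C : R) : 1 <= C -> (forall t, 0 < t -> 0 < a t) ->
  a t @[t --> 0^'+] --> +oo -> (forall s, 0 < s -> a (s / 2) <= C * a s) ->
  exists t : nat -> R, [/\ t 0%N = 1, forall j, 0 < t j,
    forall j, t j.+1 <= t j / 2,
    forall j, 2 * a (t j) <= a (t j.+1) &
    forall j, a (t j.+1) <= 2 * C * a (t j)].
Proof.
move=> C1 a0 aoo ad.
have next (s : R) : exists r, 0 < s -> [/\ 0 < r, r <= s / 2, 2 * a s <= a r & a r <= 2 * C * a s].
  have [s0|] := ltP 0 s; last by exists 0.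
  have as0 := a0 _ s0.
  pose P n := 2 * a s <= a (s / 2 ^+ n.+1).
  have exP : exists n, P n.
    move/cvgryPge : aoo => /(_ (2 * a s)) [e /= e0 He].
    pose n := Num.bound (s / e); exists n; apply: He; last by rewrite divr_gt0// exprn_gt0.
    have p2 : 0 < 2 ^+ n.+1 :> R by rewrite exprn_gt0.
    rewrite /= sub0r normrN gtr0_norm ?divr_gt0// ltr_pdivrMr// mulrC -ltr_pdivrMr//.
    apply: lt_trans (archi_boundP (divr_ge0 (ltW s0) (ltW e0))) _.
    by rewrite -natrX ltr_nat (ltn_trans (ltn_expl n (ltnSn 1)))// ltn_exp2l.
  case: (ex_minnP exP) => n Pn nmin; exists (s / 2 ^+ n.+1) => _.
  have p2 k : 0 < 2 ^+ k :> R by rewrite exprn_gt0.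
  split => //; first by rewrite divr_gt0.
    rewrite ler_pM2l// lef_pV2 ?posrE// exprS ler_peMr//.
    by rewrite exprn_ege1// ler1n.
  rewrite exprSr invfM mulrA.
  have x0 : 0 < s / 2 ^+ n by rewrite divr_gt0.
  apply: le_trans (ad _ x0) _.
  have -> : 2 * C * a s = C * (2 * a s) by ring.
  apply: ler_wpM2l; first lra.
  case: n nmin {Pn x0} => [|n] nmin; first by rewrite expr0 divr1; lra.
  by rewrite leNgt; apply/negP => /ltW H; have := nmin n H; rewrite ltnn.
have [f fP] := choice next.
pose t n := iter n f 1.
have t0 j : 0 < t j by elim: j => //= j IH; have [] := fP _ IH.
by exists t; split => // j; have [] := fP _ (t0 j).
Qed.

End slowly_varying.

(** * Functions constant on disjoint blocks *)

Section blocks.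
Context {R : realType}.
Local Notation mu := (@lebesgue_measure R).
Local Open Scope ereal_scope.
Variable t : nat -> R.
Hypotheses (tp : forall j, (0 < t j)%R) (tS : forall j, (t j.+1 <= t j / 2)%R).

(** The node t j is also the length of the block, so t_j^-1 v_j on it has
    integral v_j. *)
Definition block j : set R := `[t j, (2 * t j)%R[%classic.

Lemma measurable_block j : measurable (block j).
Proof. exact: measurable_itv. Qed.

Lemma block_pos j s : block j s -> (0 < s)%R.
Proof. by rewrite /block /= in_itv/= => /andP[+ _]; apply: lt_le_trans. Qed.

Lemma nodes_le i j : (i <= j)%N -> (t j <= t i)%R.
Proof.
elim: j => [|j IH]; first by rewrite leqn0 => /eqP ->.
rewrite leq_eqVlt => /predU1P[->//|]; rewrite ltnS => /IH; apply: le_trans.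
by apply: le_trans (tS j) _; have := tp j; lra.
Qed.

(** The blocks [t j, 2 t j) are disjoint. *)
Lemma nodes_lt i j : (i < j)%N -> (2 * t j <= t i)%R.
Proof. by move=> /nodes_le; have := tS i; lra. Qed.

Lemma block_uniq i j s : block i s -> block j s -> i = j.
Proof.
rewrite /block /= !in_itv/= => /andP[i1 i2] /andP[j1 j2].
case: (ltngtP i j) => // /nodes_lt ?; exfalso.
  by have := lt_le_trans j2 (le_trans _ i1) => /(_ ltac:(eassumption)); rewrite ltxx.
by have := lt_le_trans i2 (le_trans _ j1) => /(_ ltac:(eassumption)); rewrite ltxx.
Qed.

Lemma block_measure j : mu (block j) = (t j)%:E.
Proof.
rewrite lebesgue_measure_itv/= lte_fin ltr_pMl ?ltr1n//.
by congr EFin; ring.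
Qed.

(** The sum over j of c_j / t_j times the indicator of the j-th block dominates
    g at every point, and its integral is the sum of the c_j. *)
Lemma block_integral_le (g : R -> \bar R) (c : nat -> \bar R) :
  (forall s, pos s -> 0 <= g s) -> (forall j, 0 <= c j) ->
  (forall j s, block j s -> g s <= ((t j)^-1)%:E * c j) ->
  (forall s, pos s -> (forall j, ~ block j s) -> g s = 0) ->
  \int[mu]_(s in pos) g s <= \sum_(0 <= j <oo) c j.
Proof.
move=> g0 c0 gc gz; have mpos := @measurable_pos R.
pose G j s := (\1_(block j) s * (t j)^-1)%:E * c j.
have G0 j s : 0 <= G j s.
  by apply: mule_ge0 => //; rewrite lee_fin mulr_ge0// invr_ge0 ltW.
have mG j : measurable_fun pos (G j).
  apply: emeasurable_funM; last exact: measurable_cst.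
  apply/measurable_EFinP; apply: measurable_funM; last exact: measurable_cst.
  by apply: measurable_indic; exact: measurable_block.
have intG j : \int[mu]_(s in pos) G j s = c j.
  have -> : \int[mu]_(s in pos) G j s =
      \int[mu]_(s in pos) ((((t j)^-1)%:E * c j) * (\1_(block j) s)%:E).
    by apply: eq_integral => s _; rewrite /G EFinM -muleA muleC.
  rewrite ge0_integralZl//; last 2 first.
  - apply/measurable_EFinP; apply: measurable_indic; exact: measurable_block.
  - by rewrite mule_ge0// lee_fin invr_ge0 ltW.
  rewrite integral_indic//; last exact: measurable_block.
  rewrite setIidl; last by move=> s /block_pos; rewrite in_posE.
  transitivity (((t j)^-1)%:E * c j * (t j)%:E).
    by congr (_ * _); exact: block_measure.
  by rewrite muleAC -EFinM mulVf ?mul1e// gt_eqF.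
apply: (@le_trans _ _ (\int[mu]_(s in pos) \sum_(0 <= j <oo) G j s)).
  apply: ge0_le_lower_integral => // s s0.
  have [[j js]|nj] := pselect (exists j, block j s); last first.
    by rewrite gz// ?nneseries_ge0// => j js; apply: nj; exists j.
  apply: (le_trans (gc _ _ js)).
  apply: le_trans (@nneseries_lim_ge _ (G ^~ s) xpredT 0 j.+1 _); last by [].
  rewrite big_nat_recr//= -[leLHS]add0e; apply: leeD; first exact: sume_ge0.
  by rewrite /G indicE mem_set// mul1r.
rewrite integral_nneseries//.
by under eq_eseriesr do rewrite intG.
Qed.

End blocks.

Section steps.
Context {R : realType} {Z : lmodType R}.
Local Notation mu := (@lebesgue_measure R).
Variable t : nat -> R.
Hypotheses (tp : forall j, 0 < t j) (tS : forall j, t j.+1 <= t j / 2).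
Variable v : nat -> Z.

(** The value n + 1 stands for all points outside the first n + 1 blocks. *)
Definition block_index n s := find (fun j => s \in block t j) (iota 0 n.+1).

Definition step n s : Z :=
  let j := block_index n s in if (j <= n)%N then (t j)^-1 *: v j else 0.

Definition step_limit s : Z :=
  if pselect (exists j, block t j s) is left e
  then (t (sval (cid e)))^-1 *: v (sval (cid e)) else 0.

Lemma block_index_le n j s : (j <= n)%N -> block t j s -> block_index n s = j.
Proof.
move=> jn js; set P := fun j => s \in block t j.
have hP : has P (iota 0 n.+1).
  by apply/hasP; exists j; [rewrite mem_iota|rewrite /P mem_set].
have := nth_find 0%N hP; rewrite nth_iota ?add0n -/(block_index n s); last first.
  by move: hP; rewrite has_find size_iota.
by rewrite /P inE => /(block_uniq tp tS); exact.
Qed.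

Lemma block_index_gt n s : (forall j, (j <= n)%N -> ~ block t j s) -> block_index n s = n.+1.
Proof.
move=> H; rewrite /block_index hasNfind ?size_iota//; apply/hasPn => j.
by rewrite mem_iota add0n ltnS => /H nj; apply/negP; rewrite inE.
Qed.

Lemma stepE n j s : block t j s -> step n s = if (j <= n)%N then (t j)^-1 *: v j else 0.
Proof.
move=> js; rewrite /step; case: (leqP j n) => jn.
  by rewrite (block_index_le jn js) jn.
rewrite block_index_gt ?ltnn// => i ni /(block_uniq tp tS js) ij.
by move: ni; rewrite -ij leqNgt jn.
Qed.

Lemma step0 n s : (forall j, ~ block t j s) -> step n s = 0.
Proof. by move=> H; rewrite /step block_index_gt// ltnn. Qed.

Lemma step_limitE j s : block t j s -> step_limit s = (t j)^-1 *: v j.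
Proof.
rewrite /step_limit => js; case: pselect => [e|]; last by case; exists j.
by case: cid => i /= /(block_uniq tp tS js) ->.
Qed.

Lemma step_limit0 s : (forall j, ~ block t j s) -> step_limit s = 0.
Proof. by rewrite /step_limit => H; case: pselect => // e; exfalso; case: e => j /H. Qed.

Lemma step_cvg s : \forall n \near \oo, step n s = step_limit s.
Proof.
have [[j js]|nj] := pselect (exists j, block t j s).
  by exists j => // n /= jn; rewrite (stepE _ js) jn (step_limitE js).
apply: nearW => n; rewrite step0 ?step_limit0// => j js; apply: nj; exists j => //.
Qed.

Lemma fiber_block_index n j : (j <= n)%N -> fiber (block_index n) j = block t j.
Proof.
move=> jn; apply/seteqP; split=> [s [s0 /= sj]|s js]; last first.
  by split; [rewrite in_posE; exact: block_pos js|exact: block_index_le].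
have [[i ni is_]|H] := pselect (exists2 i, (i <= n)%N & block t i s).
  by rewrite -sj (block_index_le ni is_).
have : block_index n s = n.+1 by apply: block_index_gt => i ni is_; apply: H; exists i.
by rewrite sj => jE; move: jn; rewrite jE ltnn.
Qed.

Lemma simple_block_index n : simple_map (block_index n).
Proof.
have le_n s : (block_index n s <= n.+1)%N.
  by have := find_size (fun j => s \in block t j) (iota 0 n.+1); rewrite size_iota.
split.
  apply: (@sub_finite_set _ _ `I_n.+2); last exact: finite_II.
  by move=> _ [s _ <-]; exact: le_n.
move=> j; case: (ltngtP j n.+1) => [jn|nj|->].
- by rewrite fiber_block_index//; exact: measurable_block.
- rewrite (_ : fiber _ _ = set0)//; apply/seteqP; split => // s [_ /= sj].
  by have := le_n s; rewrite sj leqNgt nj.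
- rewrite (_ : fiber _ _ = pos `\` \bigcup_(j in `I_n.+1) block t j).
    apply: measurableD; first exact: measurable_pos.
    by apply: fin_bigcup_measurable => // i _; exact: measurable_block.
  apply/seteqP; split => s [s0 /= H]; split => //.
    move=> [i /= ni is_]; move: H.
    rewrite (block_index_le (ni : (i <= n)%N) is_) => iE.
    by move: ni; rewrite iE ltnn.
  by apply: block_index_gt => i ni is_; apply: H; exists i.
Qed.

Let phi n j : Z := if (j <= n)%N then (t j)^-1 *: v j else 0.

Let stepP n : step n = phi n \o block_index n. Proof. by []. Qed.

Lemma simple_step n : simple_map (step n).
Proof. by rewrite stepP; apply: simple_map_comp; exact: simple_block_index. Qed.

Let fin_fiber n j : phi n j != 0 -> (mu (fiber (block_index n) j) < +oo)%E.
Proof.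
rewrite /phi; case: ifP; last by rewrite eqxx.
move=> jn _; rewrite fiber_block_index//.
by rewrite [X in (X < _)%E]block_measure// ltry.
Qed.

Lemma step_integrable n : simple_integrable (step n).
Proof.
move=> z z0.
rewrite stepP (_ : pos `&` _ = pos `&` block_index n @^-1` [set j | phi n j = z])//.
rewrite measure_preimage; last exact: simple_block_index.
rewrite fsbig_finite//=; last exact: (simple_block_index n).1.
apply/lte_sum_pinfty => j _; case: ifPn => [|_]; last exact: ltry.
by rewrite inE /= => jz; apply: fin_fiber; rewrite jz.
Qed.

Lemma step_integral n : simple_integral (step n) = \sum_(j < n.+1) v j.
Proof.
rewrite stepP (simple_integral_comp (simple_block_index n) (@fin_fiber n)).
rewrite (fsbig_widen _ `I_n.+2); last 2 first.
- move=> _ [s _ <-] /=.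
  by have := find_size (fun j => s \in block t j) (iota 0 n.+1); rewrite size_iota.
- move=> j [jn nj] /=; rewrite (_ : fiber _ _ = set0) ?measure0 ?scale0r//.
  by apply/seteqP; split => // s [s0 /= sj]; apply: nj; exists s.
rewrite -fsbig_ord big_ord_recr/= /phi ltnn scaler0 addr0.
apply: eq_bigr => j _; have jn : (j <= n)%N by rewrite -ltnS.
rewrite jn fiber_block_index//.
by rewrite [X in fine X]block_measure//= scalerA divff ?scale1r// gt_eqF.
Qed.

End steps.

(** * From a K-norm to a J-representation *)

Section decomposition.
Context {R : realType} {Z : lmodType R}.
Local Notation mu := (@lebesgue_measure R).
Local Open Scope ereal_scope.
Variables (E F : normed_subspace R Z).
Hypotheses (hE : seminormed E) (hF : seminormed F).
Hypothesis defS : forall z, enorm (sum_space E F) z = 0 -> z = 0%R.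
Let hS := seminormed_sum hE hF.

(** The factor 2 leaves room above the infimum unless K vanishes. In that case
    f = 0, because the norm of the sum separates points. *)
Lemma near_optimal f (t : R) : (0 < t)%R -> carrier (sum_space E F) f ->
  exists g h, [/\ carrier E g, carrier F h, f = (g + h)%R,
    enorm E g <= 2%:E * Kfun E F f t & t%:E * enorm F h <= 2%:E * Kfun E F f t].
Proof.
move=> t0 /(Kfun_lty hE hF _ t0) Koo.
have K0 := Kfun_ge0 hE hF f t0.
have [Kz|Kn0] := eqVneq (Kfun E F f t) 0.
  have f0 : f = 0%R.
    apply: defS; apply/eqP; rewrite eq_le (esn_ge0 hS.1) andbT sum_enormE.
    have hK := Kfun_seminorm hE hF t0.
    have [t1|/ltW t1] := leP t 1%R.
      by rewrite (le_trans (Kfun_scale hE hF f t0 t1))// Kz mule0.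
    by rewrite (le_trans (Kfun_mono E hF f t1))// Kz.
  exists 0%R, 0%R; rewrite f0 addr0 (esn0 hE.1) (esn0 hF.1) mule0.
  have KK : 0 <= 2%:E * Kfun E F 0%R t by rewrite mule_ge0//; exact: Kfun_ge0.
  split => //; first by apply/hE.2; rewrite (esn0 hE.1).
  by apply/hF.2; rewrite (esn0 hF.1).
have : Kfun E F f t < 2%:E * Kfun E F f t.
  have Kf : Kfun E F f t \is a fin_num by rewrite ge0_fin_numE.
  rewrite -(fineK Kf) -EFinM lte_fin ltr_pMl ?ltr1n// fine_gt0// Koo andbT.
  by rewrite lt_neqAle eq_sym Kn0.
move=> /ereal_inf_lt[_ [[g h] [/= gE hF' fE] <-] /ltW H].
have h0 : 0 <= t%:E * enorm F h by rewrite mule_ge0 ?(esn_ge0 hF.1)// lee_fin ltW.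
exists g, h; split => //; apply: le_trans H; first exact: leeDl.
by rewrite leeDr// (esn_ge0 hE.1).
Qed.

Variable t : nat -> R.
Hypotheses (tp : forall j, (0 < t j)%R) (tS : forall j, (t j.+1 <= t j / 2)%R).
Variable f : Z.
Hypothesis fE : carrier E f.

(** K(f, .) at the previous node, started with the norm of f, which is what
    the term h 0 of the decomposition costs. *)
Definition kappa j := if j is i.+1 then Kfun E F f (t i) else enorm E f.

Lemma kappa_ge0 j : 0 <= kappa j.
Proof. by case: j => [|j] /=; [exact: esn_ge0 hE.1 _|exact: Kfun_ge0]. Qed.

Let fS : carrier (sum_space E F) f.
Proof. by apply/hS.2; apply: le_lt_trans (sum_enorm_le0 hE hF f) _; exact/hE.2. Qed.

Let kappa_fin j : kappa j \is a fin_num.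
Proof.
rewrite ge0_fin_numE ?kappa_ge0//; case: j => [|j] /=; first exact/hE.2.
exact/(Kfun_lty hE hF _ (tp j)).
Qed.

Let t_mono j : (t j.+1 <= t j)%R.
Proof. by have := tS j; have := tp j; lra. Qed.

Let kappaS j : kappa j.+1 <= kappa j.
Proof.
case: j => [|j] /=; first by exact: Kfun_le0.
exact: Kfun_mono.
Qed.

(** Take f = g_j + h_j almost optimal at t_j. The summands are the differences
    h_j - h_(j-1), with h_(-1) = 0. They equal g_(j-1) - g_j, so that both
    norms are controlled by K(f, t_(j-1)). The partial sums miss f by g_n. *)
Lemma telescoping_decomposition : exists h : nat -> Z, [/\
  forall j, carrier (inter_space E F) (h j),
  forall n, enorm E (\sum_(j < n.+1) h j - f)%R <= 2%:E * kappa n.+1 &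
  forall j, Jfun E F (h j) (2 * t j)%R <= 8%:E * kappa j].
Proof.
have [g gP] := choice (fun j => near_optimal (tp j) fS).
have {gP}[h gh] := choice gP.
pose k j := fine (kappa j).
have kE j : kappa j = (k j)%:E by rewrite /k fineK.
have kS j : (k j.+1 <= k j)%R by rewrite -lee_fin -!kE.
have k0 j : (0 <= k j)%R by rewrite -lee_fin -kE kappa_ge0.
have gB j : enorm E (g j) <= (2 * k j.+1)%:E by have [_ _ _] := gh j; rewrite EFinM -kE.
have hB j : (t j)%:E * enorm F (h j) <= (2 * k j.+1)%:E.
  by have [_ _ _ _] := gh j; rewrite EFinM -kE.
have fgh j : f = (g j + h j)%R by have [] := gh j.
have hF' j : carrier F (h j) by have [] := gh j.
have hEg j : h j = (f - g j)%R by rewrite [f](fgh j) addrC addKr.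
exists (fun j => h j - (if j is i.+1 then h i else 0))%R.
have hE' j : carrier E (h j).
  rewrite hEg; apply/hE.2; apply: le_lt_trans (esnB hE.1 _ _) _.
  by rewrite lte_add_pinfty//; apply/hE.2 => //; have [] := gh j.
split.
- move=> j; split; [apply/hE.2; apply: le_lt_trans (esnB hE.1 _ _) _|
    apply/hF.2; apply: le_lt_trans (esnB hF.1 _ _) _]; rewrite lte_add_pinfty//.
  + exact/hE.2.
  + by case: j => [|j]; [rewrite (esn0 hE.1)|exact/hE.2].
  + exact/hF.2.
  + by case: j => [|j]; [rewrite (esn0 hF.1)|exact/hF.2].
- move=> n; have -> : (\sum_(j < n.+1) (h j - (if nat_of_ord j is i.+1 then h i else 0)) = h n)%R.
    elim: n => [|n IH]; first by rewrite big_ord1 subr0.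
    by rewrite big_ord_recr/= IH addrCA subrr addr0.
  by rewrite hEg addrAC subrr add0r (esnN hE.1) kE -EFinM.
move=> j; rewrite ge_max kE -EFinM; apply/andP; split.
  case: j => [|j].
    rewrite subr0 hEg; apply: le_trans (esnB hE.1 _ _) _.
    apply: (@le_trans _ _ ((k 0%N)%:E + (2 * k 1%N)%:E)).
      by apply: leeD => //; rewrite -kE.
    by rewrite -EFinD lee_fin; have := kS 0%N; have := k0 0%N; lra.
  have -> : (h j.+1 - h j = g j - g j.+1)%R.
    by rewrite !hEg opprB addrC addrA subrK.
  apply: le_trans (esnB hE.1 _ _) _; apply: le_trans (leeD (gB _) (gB _)) _.
  by rewrite -EFinD lee_fin; have := kS j.+1; have := k0 j.+1; lra.
rewrite [(2 * t j)%:E]EFinM -muleA.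
have F0 z : 0 <= enorm F z by exact: esn_ge0 hF.1 _.
have [tF tF2] : (t j)%:E * enorm F (h j) <= (2 * k j.+1)%:E /\
  (t j)%:E * enorm F (if j is i.+1 then h i else 0)%R <= (k j)%:E.
  split => //; case: j => [|j]; first by rewrite (esn0 hF.1) mule0 -kE kappa_ge0.
  apply: (@le_trans _ _ ((t j / 2)%:E * enorm F (h j))).
    by apply: lee_wpmul2r => //; rewrite lee_fin.
  rewrite mulrC EFinM -muleA -[k j.+1](mulKf (_ : 2 != 0)%R)//.
  by rewrite (EFinM _ (2 * k _)%R) lee_wpmul2l// lee_fin invr_ge0.
apply: (@le_trans _ _ (2%:E * ((2 * k j.+1)%:E + (k j)%:E))).
  apply: lee_wpmul2l => //; apply: le_trans (leeD tF tF2).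
  rewrite -ge0_muleDr//; apply: lee_wpmul2l; first by rewrite lee_fin ltW.
  exact: (esnB hF.1).
by rewrite -EFinD -EFinM lee_fin; have := kS j; have := k0 j; lra.
Qed.

End decomposition.

Section representation.
Context {R : realType} {Z : lmodType R}.
Local Notation mu := (@lebesgue_measure R).
Local Open Scope ereal_scope.

Lemma nneseries_tail (c : nat -> \bar R) n : (forall j, 0 <= c j) ->
  \sum_(0 <= j <oo) (if (n <= j)%N then c j else 0) = \sum_(n <= j <oo) c j.
Proof.
move=> c0; rewrite [RHS]eseries_cond [RHS]eseries_mkcond.
by apply: eq_eseriesr => j _; rewrite andTb.
Qed.

Variables (E F : normed_subspace R Z).
Hypotheses (hE : seminormed E) (hF : seminormed F).
Hypothesis defS : forall z, enorm (sum_space E F) z = 0 -> z = 0%R.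
Let hS := seminormed_sum hE hF.
Variable t : nat -> R.
Hypotheses (t0 : t 0 = 1%R) (tp : forall j, (0 < t j)%R) (tS : forall j, (t j.+1 <= t j / 2)%R).
Variable a : R -> R.
Hypotheses (a0 : forall s, (0 < s)%R -> (0 < a s)%R)
  (a_ni : forall s r, (0 < s)%R -> (s <= r)%R -> (a r <= a s)%R).
Variable f : Z.
Hypothesis fE : carrier E f.
Local Notation kappa := (kappa E F t f).

(** The summands of the telescoping decomposition are spread over the disjoint
    blocks: u(s) / s is constant on each block and has the j-th summand as its
    integral there. *)
Lemma J_decomposition :
  \sum_(0 <= j <oo) ((a (t j))%:E * kappa j) < +oo ->
  exists2 u, J_representation E F f u &
    \int[mu]_(s in pos) ((s^-1 * a s)%:E * Jfun E F (u s) s) <=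
      8%:E * \sum_(0 <= j <oo) ((a (t j))%:E * kappa j).
Proof.
move=> sumoo; have mpos := @measurable_pos R.
have [v [vc vsum vJ]] := telescoping_decomposition hE hF defS tp tS fE.
have kp0 j : 0 <= kappa j by exact: kappa_ge0.
have ak0 j : 0 <= (a (t j))%:E * kappa j by rewrite mule_ge0// lee_fin ltW// a0.
have E0 := esn_ge0 hE.1; have S0 := esn_ge0 hS.1.
have t_le1 j : (t j <= 1)%R by rewrite -t0; exact: (nodes_le tp tS).
have skoo : \sum_(0 <= j <oo) kappa j < +oo.
  have a1 := a0 ltr01.
  have H : \sum_(0 <= j <oo) kappa j <= (a 1%R)^-1%:E * \sum_(0 <= j <oo) ((a (t j))%:E * kappa j).
    rewrite -nneseriesZl; last by move=> j _; exact: ak0.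
    apply: lee_nneseries => [j _ _|j _]; first exact: kp0.
    rewrite muleA -EFinM -[leLHS]mul1e.
    by apply: lee_wpmul2r => //; rewrite lee_fin mulrC ler_pdivlMr// mul1r a_ni.
  apply: le_lt_trans H _; apply: lte_mul_pinfty => //.
  by rewrite lee_fin invr_ge0 ltW.
have tail0 : \sum_(n <= j <oo) kappa j @[n --> \oo] --> 0.
  exact: nneseries_tail_cvg.
have kp_cvg : kappa n @[n --> \oo] --> 0.
  apply: le_nncvg0 tail0 => //; apply: nearW => n.
  apply: le_trans (@nneseries_lim_ge _ kappa xpredT n n.+1 _); last by [].
  by rewrite big_nat1.
have vE j : enorm E (v j) <= 8%:E * kappa j.
  by apply: le_trans (vJ j); rewrite le_max lexx.
pose w := step_limit t v.
have wstep s : \forall n \near \oo, step t v n s = w s := step_cvg tp tS v s.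
have hI := seminormed_inter hE hF.
have cI0 : carrier (inter_space E F) 0%R by apply/hI.2; rewrite (esn0 hI.1).
have cstep n s : carrier (inter_space E F) (step t v n s).
  by rewrite /step; case: ifP => // _; exact: carrierZ.
have cw s : carrier (inter_space E F) (w s).
  by have [n _ /(_ n (leqnn n)) <-] := wstep s.
have sw : strongly_measurable (inter_space E F) w.
  split; first by [].
  exists (step t v); split.
    by move=> n; apply/simple_inP; split => //; exact: (simple_step tp tS).
  apply: aeW => s s0; apply: cvg_near_cst; apply: filterS (wstep s) => n ->.
  by rewrite subrr (esn0 hI.1).
pose u s := (s *: w s)%R.
have su : strongly_measurable (inter_space E F) u.
  apply: (strongly_measurableZ (rho := id)) => //.
  by move=> s; rewrite in_posE => /ltW.
exists u.
  split => //; split; first by apply/hS.2; apply: le_lt_trans (sum_enorm_le0 hE hF f) _; exact/hE.2.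
    apply: strongly_measurableZ => //; first exact: measurable_inv_pos.
      by move=> s; rewrite in_posE invr_ge0 => /ltW.
    apply: sub_strongly_measurable su => // z.
    by apply: le_trans (sum_enorm_le0 hE hF z) _; rewrite le_max lexx.
  exists (step t v); split.
  - move=> n; split; last exact: (step_integrable tp tS).
    apply/simple_inP; split; first exact: (simple_step tp tS).
    move=> s _; apply/hS.2; apply: le_lt_trans (sum_enorm_le0 hE hF _) _.
    by apply/hE.2; have [] := cstep n s.
  - apply: (@le_nncvg0 _ _ (fun n => 8%:E * \sum_(n.+1 <= j <oo) kappa j)).
    + by move=> n; apply: integral_ge0.
    + apply: nearW => n.
      rewrite -nneseriesZl// -nneseries_tail; last by move=> j; rewrite mule_ge0.
      apply: (block_integral_le tp) => //.
      * by move=> j; case: ifP => // _; rewrite mule_ge0.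
      * move=> j s js; have s0 := block_pos tp js.
        rewrite /u scalerA mulVf ?gt_eqF// scale1r /w (step_limitE tp tS _ js) (stepE tp tS _ _ js).
        have [jn|jn] := leqP j n.
          by rewrite subrr (esn0 hS.1) mule0.
        rewrite sub0r (esnN hS.1) (esnZ hS.1) ger0_norm; last by rewrite invr_ge0 ltW.
        apply: lee_wpmul2l; first by rewrite lee_fin invr_ge0 ltW.
        exact: le_trans (sum_enorm_le0 hE hF _) (vE j).
      * move=> s s0 ns; rewrite /u /w (step_limit0 _ ns) (step0 _ _ ns).
        by rewrite !scaler0 subrr (esn0 hS.1).
    + by apply: nncvg0Z; rewrite (cvg_shiftS (fun n => \sum_(n <= j <oo) kappa j)).
  - apply: (@le_nncvg0 _ _ (fun n => 2%:E * kappa n.+1)) => //.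
    + apply: nearW => n; rewrite (step_integral tp tS).
      exact: le_trans (sum_enorm_le0 hE hF _) (vsum n).
    + by apply: nncvg0Z; rewrite (cvg_shiftS kappa).
rewrite -nneseriesZl; last by move=> j _; exact: ak0.
apply: (block_integral_le tp).
- move=> s; rewrite in_posE => s0; rewrite mule_ge0//.
    by rewrite lee_fin mulr_ge0 ?invr_ge0 ?(ltW s0) ?(ltW (a0 s0)).
  exact: esn_ge0 (Jfun_seminorm hE hF s0) _.
- by move=> j; rewrite mule_ge0.
- move=> j s js; have s0 := block_pos tp js.
  have tj0 := tp j.
  have [tjs sj] : (t j <= s)%R /\ (s <= 2 * t j)%R.
    by move: js; rewrite /block /= in_itv/= => /andP[-> /ltW].
  rewrite /u /w (step_limitE tp tS _ js) scalerA (esnZ (Jfun_seminorm hE hF s0)).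
  rewrite ger0_norm; last by rewrite divr_ge0 ?(ltW s0) ?(ltW tj0).
  rewrite muleA -EFinM.
  have -> : (s^-1 * a s * (s / t j) = (t j)^-1 * a s)%R.
    by field; rewrite !gt_eqF.
  rewrite EFinM -muleA; apply: lee_wpmul2l; first by rewrite lee_fin invr_ge0 ltW.
  rewrite muleCA; apply: (@le_trans _ _ ((a (t j))%:E * Jfun E F (v j) s)).
    apply: lee_wpmul2r; first exact: esn_ge0 (Jfun_seminorm hE hF s0) _.
    by rewrite lee_fin a_ni.
  apply: lee_wpmul2l; first by rewrite lee_fin ltW// a0.
  apply: le_trans (vJ j); rewrite /Jfun ge_max !le_max lexx/= orbC.
  apply/orP; left; apply: lee_wpmul2r; first exact: esn_ge0 hF.1 _.
  by rewrite lee_fin.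
- move=> s s0 ns; rewrite /u /w (step_limit0 _ ns) scaler0.
  rewrite in_posE in s0.
  by rewrite (esn0 (Jfun_seminorm hE hF s0)) mule0.
Qed.

End representation.

(** * The inclusions between the interpolation spaces *)

Section inclusions.
Context {R : realType} {Z : lmodType R}.
Local Notation mu := (@lebesgue_measure R).
Local Open Scope ereal_scope.
Variables (E F : normed_subspace R Z).
Hypotheses (hE : seminormed E) (hF : seminormed F).
Hypothesis defS : forall z, enorm (sum_space E F) z = 0 -> z = 0%R.
Hypothesis compE : seq_complete E.
Let hS := seminormed_sum hE hF.

Lemma L1norm_ge0E (g : R -> \bar R) : (forall s, (0 < s)%R -> 0 <= g s) ->
  L1norm g = \int[mu]_(s in pos) g s.
Proof.
by move=> g0; apply: eq_integral => s; rewrite inE in_posE => s0; rewrite gee0_abs// g0.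
Qed.

Lemma Jweight_ge0 (v : R -> R) (u : R -> Z) s : (0 < s)%R -> (0 <= v s)%R ->
  0 <= (s^-1 * v s)%:E * Jfun E F (u s) s.
Proof.
move=> s0 v0; apply: mule_ge0; first by rewrite lee_fin mulr_ge0// invr_ge0 ltW.
exact: esn_ge0 (Jfun_seminorm hE hF s0) _.
Qed.

Lemma Jnorm_le (v : R -> R) f (x : \bar R) (c : R) : (0 < c)%R ->
  (forall s, (0 < s)%R -> (0 <= v s)%R) ->
  (forall u, J_representation E F f u ->
     x <= c%:E * \int[mu]_(s in pos) ((s^-1 * v s)%:E * Jfun E F (u s) s)) ->
  x <= c%:E * enorm (J_space E F v) f.
Proof.
move=> c0 v0 H; apply: ereal_inf_leM => // _ [u uf <-].
rewrite L1norm_ge0E; first exact: H.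
by move=> s s0; apply: Jweight_ge0 => //; exact: v0.
Qed.

Lemma Jnorm_ub (v : R -> R) f u : (forall s, (0 < s)%R -> (0 <= v s)%R) ->
  J_representation E F f u ->
  enorm (J_space E F v) f <= \int[mu]_(s in pos) ((s^-1 * v s)%:E * Jfun E F (u s) s).
Proof.
move=> v0 uf; rewrite -L1norm_ge0E; first by apply: ereal_inf_lbound; exists u.
by move=> s s0; apply: Jweight_ge0 => //; exact: v0.
Qed.

Lemma Jnorm_ge0 (v : R -> R) f : 0 <= enorm (J_space E F v) f.
Proof.
apply: le_ereal_inf_tmp => _ [u _ <-].
by apply: integral_ge0 => s _; exact: abse_ge0.
Qed.

Lemma max_le_scale (x y z : \bar R) (c d : R) : 0 <= z ->
  x <= c%:E * z -> y <= d%:E * z -> maxe x y <= (Num.max c d)%:E * z.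
Proof.
move=> z0 xz yz; rewrite ge_max; apply/andP; split.
  by apply: (le_trans xz); apply: lee_wpmul2r; rewrite // lee_fin le_max lexx.
by apply: (le_trans yz); apply: lee_wpmul2r; rewrite // lee_fin le_max lexx orbT.
Qed.

(** A weight bounded below makes every admissible representation converge
    absolutely in the first space. *)
Lemma Jspace_in_left (a : R -> R) (l : R) f : (0 < l)%R ->
  (forall s, (0 < s)%R -> (l <= a s)%R) ->
  carrier (J_space E F a) f ->
  carrier E f /\ enorm E f <= (l^-1)%:E * enorm (J_space E F a) f.
Proof.
move=> l0 la [fS _ Noo].
have a0 s : (0 < s)%R -> (0 <= a s)%R by move=> /la; apply: le_trans; exact: ltW.
have mpos := @measurable_pos R.
pose Ja u := \int[mu]_(s in pos) ((s^-1 * a s)%:E * Jfun E F (u s) s).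
have key u : J_representation E F f u -> Ja u < +oo ->
    carrier E f /\ enorm E f <= (l^-1)%:E * Ja u.
  move=> uf Joo.
  have H : \int[mu]_(s in pos) ((s^-1)%:E * enorm E (u s)) <= (l^-1)%:E * Ja u.
    apply: le_trans (ge0_integral_leZ _ _ _ _); rewrite ?invr_gt0//; last first.
      by move=> s; rewrite in_posE => s0; apply: Jweight_ge0 => //; exact: a0.
    apply: ge0_le_lower_integral => //.
      by move=> s; rewrite in_posE => s0; rewrite mule_ge0 ?(esn_ge0 hE.1)// lee_fin invr_ge0 ltW.
    move=> s; rewrite in_posE => s0; rewrite muleA -EFinM.
    apply: lee_pmul; rewrite ?(esn_ge0 hE.1) ?lee_fin ?invr_ge0 ?(ltW s0)//; last first.
      by rewrite le_max lexx.
    by rewrite mulrCA ler_peMr ?invr_ge0 ?(ltW s0)// mulrC ler_pdivlMr// mul1r la.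
  have Hoo : \int[mu]_(s in pos) ((s^-1)%:E * enorm E (u s)) < +oo.
    by apply: le_lt_trans H _; rewrite lte_mul_pinfty// lee_fin invr_ge0 ltW.
  have [cf fl] := representation_in_left hE hF defS compE uf Hoo.
  by split => //; exact: le_trans fl H.
have [_ [u uf <-]] := ereal_inf_lt Noo.
rewrite L1norm_ge0E; last by move=> s s0; apply: Jweight_ge0 => //; exact: a0.
move=> Joo; split; first by have [] := key u uf Joo.
apply: Jnorm_le => //; first by rewrite invr_gt0.
move=> w wf; have [/(key w wf)[]//|] := ltP (Ja w) +oo.
by rewrite leye_eq => /eqP; rewrite /Ja => ->; rewrite gt0_muley ?leey// lte_fin invr_gt0.
Qed.

Lemma Jspace_le (a A : R -> R) (M : R) f : (0 < M)%R ->
  (forall s, (0 < s)%R -> (0 <= A s)%R) -> (forall s, (0 < s)%R -> (0 <= a s)%R) ->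
  (forall s, (0 < s)%R -> (A s <= M * a s)%R) ->
  carrier (J_space E F a) f ->
  carrier (J_space E F A) f /\ enorm (J_space E F A) f <= M%:E * enorm (J_space E F a) f.
Proof.
move=> M0 A0 a0 AM [fS fu Noo].
have H : enorm (J_space E F A) f <= M%:E * enorm (J_space E F a) f.
  apply: Jnorm_le => // u uf; apply: le_trans (Jnorm_ub A0 uf) _.
  apply: le_trans (ge0_integral_leZ _ _ _ _) => //; last 2 first.
  - exact: measurable_pos.
  - by move=> s; rewrite in_posE => s0; apply: Jweight_ge0 => //; exact: a0.
  apply: ge0_le_lower_integral; first exact: measurable_pos.
    by move=> s; rewrite in_posE => s0; apply: Jweight_ge0 => //; exact: A0.
  move=> s; rewrite in_posE => s0; rewrite muleA -EFinM.
  apply: lee_wpmul2r; first exact: esn_ge0 (Jfun_seminorm hE hF s0) _.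
  by rewrite lee_fin mulrCA ler_wpM2l ?invr_ge0 ?(ltW s0)// AM.
split; last exact: H.
split; [exact: fS|exact: fu|]; apply: le_lt_trans H _.
by rewrite lte_mul_pinfty// lee_fin ltW.
Qed.

Lemma Jfun_measurable u : strongly_measurable (inter_space E F) u ->
  exists j, [/\ measurable_fun pos j, forall s, 0 <= j s &
    {ae mu, forall s, pos s -> Jfun E F (u s) s = j s}].
Proof.
move=> su.
have lE z : enorm E z <= 1%:E * enorm (inter_space E F) z by rewrite mul1e le_max lexx.
have lF z : enorm F z <= 1%:E * enorm (inter_space E F) z by rewrite mul1e le_max lexx orbT.
have [g1 [mg1 g10 ug1]] := ae_measurable_ge0 (mu := mu) (fun s _ => esn_ge0 hE.1 (u s))
  (strongly_measurable_esn hE.1 lE su).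
have [g2 [mg2 g20 ug2]] := ae_measurable_ge0 (mu := mu) (fun s _ => esn_ge0 hF.1 (u s))
  (strongly_measurable_esn hF.1 lF su).
exists (fun s => maxe (g1 s) (s%:E * g2 s)); split.
- by apply: measurable_maxe => //; exact: emeasurable_funM.
- by move=> s; rewrite le_max g10.
- by apply: filterS2 ug1 ug2 => s u1 u2 s0; rewrite /Jfun u1// u2.
Qed.

Section weight.
Variables (A B : R -> R) (h : R -> \bar R).
Hypothesis mh : measurable_fun setT h.
Hypothesis h0 : forall x, 0 <= h x.
Hypothesis hB : {ae mu, forall x, pos x -> `|x^-1 * B x|%:E = h x}.
Hypothesis hA : forall x y, (0 < x)%R -> (x <= y)%R ->
  \int[mu]_(t in `]x, y]) h t = (A x - A y)%:E.
Hypothesis A0 : forall s, (0 < s)%R -> (0 <= A s)%R.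

(** Both sides integrate the same function up to a null set, by the
    description of B through the derivative of A. *)
Lemma Knorm_density f : enorm (K_space E F B) f = \int[mu]_(s in pos) (h s * Kfun E F f s).
Proof.
apply: ge0_eq_integral_ae.
- exact: measurable_pos.
- by move=> s _; exact: abse_ge0.
- by move=> s; rewrite in_posE => s0; rewrite mule_ge0//; exact: Kfun_ge0.
apply: filterS hB => s hs s0; have := s0; rewrite in_posE => s0'.
by rewrite abseM [X in _ * X]gee0_abs ?Kfun_ge0// -(hs s0).
Qed.

(** The K-functional is dominated by an average of the J-functional; the Hardy
    inequality then exchanges the weight of K for that of J. *)
Lemma Jspace_sub_Kspace (C : R) f : (0 < C)%R ->
  (forall s k, (0 < s)%R -> (A (s / 4 ^+ k) <= C * 2 ^+ k * A s)%R) ->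
  carrier (J_space E F A) f ->
  carrier (K_space E F B) f /\
  enorm (K_space E F B) f <= (4 * C + 1)%:E * enorm (J_space E F A) f.
Proof.
move=> C0 AC [fS fu Noo].
have D0 : (0 < 4 * C + 1)%R by lra.
have mpos := @measurable_pos R.
have H : enorm (K_space E F B) f <= (4 * C + 1)%:E * enorm (J_space E F A) f.
  apply: Jnorm_le => // u uf; rewrite Knorm_density.
  have [j [mj j0 uj]] : exists j, [/\ measurable_fun pos j, forall s, 0 <= j s &
      {ae mu, forall s, pos s -> Jfun E F (u s) s = j s}].
    exact: Jfun_measurable uf.1.
  have -> : \int[mu]_(s in pos) ((s^-1 * A s)%:E * Jfun E F (u s) s) =
      \int[mu]_(s in pos) ((s^-1 * A s)%:E * j s).
    apply: ge0_eq_integral_ae => //.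
    - by move=> s; rewrite in_posE => s0; apply: Jweight_ge0 => //; exact: A0.
    - move=> s; rewrite in_posE => s0; rewrite mule_ge0//.
      by rewrite lee_fin mulr_ge0 ?A0// invr_ge0 ltW.
    - by apply: filterS uj => s us s0; rewrite us.
  apply: le_trans (weighted_hardy _ h0 mj j0 D0 A0 _).
  - apply: ge0_le_lower_integral => //.
      by move=> s; rewrite in_posE => s0; rewrite mule_ge0//; exact: Kfun_ge0.
    move=> s; rewrite in_posE => s0; apply: lee_wpmul2l => //.
    apply: (le_trans (Kfun_representation_le hE hF s0 uf)).
    apply: ge0_le_integral_ae => //.
    + move=> r; rewrite in_posE => r0; rewrite mule_ge0//.
        by rewrite lee_fin mulr_ge0 ?invr_ge0 ?(ltW r0)// le_min ler01 divr_ge0 ?(ltW r0) ?(ltW s0).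
      exact: esn_ge0 (Jfun_seminorm hE hF r0) _.
    + move=> r; rewrite in_posE => r0; rewrite mule_ge0//.
      by rewrite lee_fin mulr_ge0 ?invr_ge0 ?(ltW r0)// le_min ler01 divr_ge0 ?(ltW r0) ?(ltW s0).
    + by apply: filterS uj => r ur r0; rewrite ur.
  - exact: measurable_funTS.
  - move=> s s0; apply: (weight_bound mh h0 hA A0 (ltW C0) AC s0).
split; last exact: H.
split; first exact: fS.
apply: le_lt_trans H _.
by rewrite lte_mul_pinfty// lee_fin ltW.
Qed.

Variable a : R -> R.
Hypothesis a0 : forall s, (0 < s)%R -> (0 < a s)%R.
Hypothesis a_ni : forall s r, (0 < s)%R -> (s <= r)%R -> (a r <= a s)%R.
Hypothesis aA : forall s, (0 < s)%R -> (s <= 1)%R -> A s = a s.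

(** On (t_(j+1), t_j] the K-functional is at least its value at t_(j+1), and
    the density integrates to the increment of A. *)
Lemma Kfun_block_sum_le (t : nat -> R) f : carrier (sum_space E F) f ->
  (forall j, (0 < t j)%R) -> (forall j, (t j.+1 <= t j)%R) ->
  \sum_(0 <= j <oo) ((A (t j.+1) - A (t j))%:E * Kfun E F f (t j.+1)) <=
  \int[mu]_(s in pos) (h s * Kfun E F f s).
Proof.
move=> fS tp tS.
have mpos := @measurable_pos R.
pose D j : set R := `](t j.+1), (t j)]%classic.
have mD j : measurable (D j) by exact: measurable_itv.
have Dpos : \bigcup_j D j `<=` pos.
  move=> s [j _]; rewrite /D /= in_itv/= in_posE => /andP[+ _].
  exact: lt_trans.
have t_mono i j : (i <= j)%N -> (t j <= t i)%R.
  elim: j => [|j IH]; first by rewrite leqn0 => /eqP ->.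
  rewrite leq_eqVlt => /predU1P[->//|]; rewrite ltnS => /IH; exact: le_trans.
have tD : trivIset setT D.
  apply: ltn_trivIset => j i ij; rewrite -subset0 => s [].
  rewrite /D /= !in_itv/= => /andP[i1 i2] /andP[j1 j2].
  by have := t_mono _ _ ij; lra.
have mK : measurable_fun pos (fun s => h s * Kfun E F f s).
  apply: emeasurable_funM; first exact: measurable_funTS.
  pose k s := if (0 < s)%R then fine (Kfun E F f s) else 0%R.
  have Kf s : (0 < s)%R -> Kfun E F f s \is a fin_num.
    by move=> s0; rewrite ge0_fin_numE ?Kfun_ge0//; exact/(Kfun_lty hE hF _ s0).
  have mk : measurable_fun pos k.
    apply: nondecreasing_measurable => // r s rs; rewrite /k.
    case: ifPn => r0; last by case: ifPn => // s0; rewrite fine_ge0// Kfun_ge0.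
    rewrite (lt_le_trans r0 rs) fine_le ?Kf//; first exact: lt_le_trans rs.
    exact: Kfun_mono.
  apply: (eq_measurable_fun (EFin \o k)); last exact/measurable_EFinP.
  by move=> s; rewrite inE in_posE => s0; rewrite /= /k s0 fineK// Kf.
apply: (@le_trans _ _ (\int[mu]_(s in \bigcup_j D j) (h s * Kfun E F f s))); last first.
  apply: ge0_subset_integral => //; first exact: bigcupT_measurable.
  by move=> s; rewrite in_posE => s0; rewrite mule_ge0// Kfun_ge0.
rewrite ge0_integral_bigcup//; last 2 first.
- by apply: measurable_funS mK.
- by move=> s /Dpos; rewrite in_posE => s0; rewrite mule_ge0// Kfun_ge0.
apply: lee_nneseries => [j _ _|j _].
  rewrite mule_ge0 ?Kfun_ge0// -hA//; exact: integral_ge0.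
rewrite -hA// muleC -ge0_integralZl//; last 2 first.
- exact: measurable_funTS.
- exact: Kfun_ge0.
apply: ge0_le_lower_integral => //.
  by move=> s _; rewrite mule_ge0// Kfun_ge0.
move=> s; rewrite /D /= in_itv/= => /andP[ts _]; rewrite muleC.
by apply: lee_wpmul2l => //; apply: Kfun_mono => //; exact: ltW.
Qed.

(** Between consecutive nodes a at least doubles, hence a(t_j) is at most twice
    the increment of a, which is also that of A since the nodes lie in (0, 1].
    As a(t_(j+1)) is at most a multiple of a(t_j), the sum in the decomposition
    is controlled by the K-norm, except for its first two terms, which the norm
    of f controls. *)
Lemma Kspace_sub_Jspace (C : R) f : (1 <= C)%R ->
  a t @[t --> 0%R^'+] --> +oo%R -> (forall s, (0 < s)%R -> (a (s / 2) <= C * a s)%R) ->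
  carrier E f -> carrier (K_space E F B) f ->
  carrier (J_space E F a) f /\
  enorm (J_space E F a) f <=
    (8 * (a 1 + 2 * C * a 1 + 4 * C))%:E * maxe (enorm E f) (enorm (K_space E F B) f).
Proof.
move=> C1 aoo ad fE [fS Noo].
have [t [t0 tp tS t2 tC]] := jump_sequence C1 a0 aoo ad.
have tS' j : (t j.+1 <= t j)%R by have := tS j; have := tp j; lra.
have t1 j : (t j <= 1)%R by rewrite -t0; exact: (nodes_le tp tS).
have At j : A (t j) = a (t j) by rewrite aA.
have a00 s : (0 < s)%R -> (0 <= a s)%R by move=> /a0/ltW.
have kp0 := kappa_ge0 hE hF tp.
set NB := enorm (K_space E F B) f in Noo *.
have NBE : NB = \int[mu]_(s in pos) (h s * Kfun E F f s) by exact: Knorm_density.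
pose S := \sum_(0 <= j <oo) ((a (t j))%:E * kappa E F t f j).
have ak0 j : 0 <= (a (t j))%:E * kappa E F t f j.
  by rewrite mule_ge0// lee_fin a00.
have S_le : S <= (a 1%R)%:E * enorm E f + ((2 * C * a 1)%:E * enorm E f + (4 * C)%:E * NB).
  rewrite /S (nneseries_split 0 2)// big_mkord !big_ord_recl big_ord0 adde0 -addeA.
  rewrite /= t0; apply: leeD => //; apply: leeD.
    rewrite /bump /= add1n; apply: lee_pmul; rewrite ?lee_fin ?a00// ?Kfun_ge0//.
      by have := tC 0%N; rewrite t0.
    exact: Kfun_le0.
  rewrite add0n -(nneseries_addn 2)// NBE.
  apply: (@le_trans _ _ ((4 * C)%:E *
    \sum_(0 <= j <oo) ((A (t j.+1) - A (t j))%:E * Kfun E F f (t j.+1)))); last first.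
    by apply: lee_wpmul2l; [rewrite lee_fin; lra|exact: Kfun_block_sum_le].
  have dA j : (0 <= A (t j.+1) - A (t j))%R.
    by rewrite subr_ge0 !At; apply: a_ni.
  rewrite -nneseriesZl; last by move=> j _; rewrite mule_ge0 ?lee_fin// Kfun_ge0.
  apply: lee_nneseries => [j _ _|j _]; first exact: ak0.
  rewrite addn2 /= muleA -EFinM; apply: lee_wpmul2r; first exact: Kfun_ge0.
  rewrite lee_fin !At; have := tC j.+1; have := t2 j.
  have := a0 (tp j.+1); have := a0 (tp j); nra.
pose M := maxe (enorm E f) NB.
have E0 : 0 <= enorm E f by exact: esn_ge0 hE.1 _.
have NB0 : 0 <= NB.
  rewrite NBE; apply: integral_ge0 => s; rewrite in_posE => s0.
  by rewrite mule_ge0// Kfun_ge0.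
have M0 : 0 <= M by rewrite le_max E0.
have S_leM : S <= (a 1 + 2 * C * a 1 + 4 * C)%:E * M.
  apply: (le_trans S_le); have a1 := a0 ltr01.
  have c1 : 0 <= (a 1%R)%:E by rewrite lee_fin ltW.
  have c2 : 0 <= (2 * C * a 1)%:E by rewrite lee_fin !mulr_ge0//; lra.
  have c3 : 0 <= (4 * C)%:E by rewrite lee_fin; lra.
  rewrite !EFinD !ge0_muleDl ?adde_ge0// -addeA.
  apply: leeD; first by apply: lee_wpmul2l => //; rewrite le_max lexx.
  apply: leeD; first by apply: lee_wpmul2l => //; rewrite le_max lexx.
  by apply: lee_wpmul2l => //; rewrite le_max lexx orbT.
have Moo : M < +oo by rewrite gt_max Noo andbT; exact/hE.2.
have c0 : (0 <= a 1 + 2 * C * a 1 + 4 * C)%R.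
  by have := a0 ltr01; nra.
have Soo : S < +oo.
  by apply: le_lt_trans S_leM _; rewrite lte_mul_pinfty.
have [u uf uS] := J_decomposition hE hF defS t0 tp tS a0 a_ni fE Soo.
have H : enorm (J_space E F a) f <= (8 * (a 1 + 2 * C * a 1 + 4 * C))%:E * M.
  apply: le_trans (Jnorm_ub a00 uf) _; apply: (le_trans uS).
  by rewrite EFinM -muleA; apply: lee_wpmul2l.
split; last exact: H.
split; [exact: fS|by exists u|].
apply: le_lt_trans H _; rewrite lte_mul_pinfty// lee_fin; lra.
Qed.

End weight.
End inclusions.

(** * The theorem *)

(** A vector of norm 0 in the sum is the sum of two sequences tending to 0 in
    the two spaces, hence in the ambient space, where limits are unique. *)
Lemma sum_enorm_definite (R : realType) (Z : topologicalLmodType R)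
    (X0 X1 : completeNormedModType R)
    (i0 : {linear X0 -> Z}) (i1 : {linear X1 -> Z}) :
  compatible_couple i0 i1 ->
  forall z, (enorm (sum_space (embedded i0) (embedded i1)) z = 0)%E -> z = 0.
Proof.
move=> [hZ [inj0 c0] [inj1 c1]] z z0.
have dec (n : nat) : exists p : X0 * X1,
    z = i0 p.1 + i1 p.2 /\ `|p.1| < n.+1%:R^-1 /\ `|p.2| < n.+1%:R^-1.
  have n0 : (0 < n.+1%:R^-1 :> R)%R by rewrite invr_gt0.
  have : (enorm (sum_space (embedded i0) (embedded i1)) z < (n.+1%:R^-1)%:E)%E.
    by rewrite z0 lte_fin.
  move=> /ereal_inf_lt[_ [[y0 y1] [[x _ xy0] [y _ yy1] /= ->] <-]].
  rewrite -[y0]xy0 -[y1]yy1 /=.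
  have := enorm_embedded x inj0; have := enorm_embedded y inj1; rewrite /= => -> ->.
  rewrite -EFinD lte_fin => H; exists (x, y) => /=; split => //.
  by split; apply: le_lt_trans H; rewrite ?lerDl ?lerDr.
have [p pP] := choice dec.
have small (X : completeNormedModType R) (q : nat -> X) :
    (forall n, `|q n| < n.+1%:R^-1) -> q n @[n --> \oo] --> (0 : X).
  move=> H; apply/cvgr0Pnorm_lt => e e0; near=> n.
  apply: lt_trans (H n) _; near: n; exact: near_infty_natSinv_lt (PosNum e0).
have q0 : i0 (p n).1 @[n --> \oo] --> (0 : Z).
  rewrite -(linear0 i0); apply: (cvg_comp (fun n => (p n).1) i0 _ (c0 0)).
  by apply: small => n; have [_ []] := pP n.
have q1 : i1 (p n).2 @[n --> \oo] --> (0 : Z).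
  rewrite -(linear0 i1); apply: (cvg_comp (fun n => (p n).2) i1 _ (c1 0)).
  by apply: small => n; have [_ []] := pP n.
have zc : i0 (p n).1 + i1 (p n).2 @[n --> \oo] --> (0 : Z).
  rewrite -[X in _ --> X](addr0 0).
  apply: (cvg_comp (fun n => (i0 (p n).1, i1 (p n).2)) (fun y : Z * Z => y.1 + y.2)
    _ (@add_continuous Z (0, 0))).
  exact: cvg_pair q0 q1.
have zc' : i0 (p n).1 + i1 (p n).2 @[n --> \oo] --> z.
  rewrite (_ : (fun n => _) = cst z); first exact: cvg_cst.
  by apply/funext => n; have [<-] := pP n.
exact: (cvg_unique hZ zc' zc).
Unshelve. all: by end_near. Qed.

(** Only the passage through the point 1 is not immediate. It follows from the
    continuity of A there. *)
Lemma glued_nonincreasing (R : realType) (a alpha A : R -> R) (c : R) :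
  strictly_decreasing a -> strictly_decreasing alpha -> 0 < c ->
  (forall x, 0 < x -> x <= 1 -> A x = a x) ->
  (forall x, 1 < x -> A x = c * alpha x) ->
  locally_abs_continuous A ->
  forall s t, 0 < s -> s <= t -> A t <= A s.
Proof.
move=> ad ald c0 Al Ar Aac.
have dec f : strictly_decreasing f -> forall s t : R, 0 < s -> s <= t -> f t <= f s.
  by move=> fd s t s0; rewrite le_eqVlt => /predU1P[->//|/(fd _ _ s0)/ltW].
have A1 t : 1 < t -> A t <= A 1.
  move=> t1; apply/ler_addgt0Pr => e e0.
  have [d d0 H] := Aac 1 t ltr01 (ltW t1) e e0.
  (* a point of (1, t] at which A is e-close to A 1 *)
  pose x := Num.min t (1 + d / 2).
  have [x1 xt xd] : [/\ 1 < x, x <= t & x - 1 < d].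
    by rewrite /x; case: (leP t (1 + d / 2)) => ?; split; lra.
  have Atx : A t <= A x.
    rewrite !Ar// ler_pM2l//; apply: dec => //; exact: lt_trans x1.
  have := H 1%N (fun=> 1) (fun=> x); rewrite !big_ord1 => /(_ _ _ xd) K.
  have {K} : `|A x - A 1| < e.
    apply: K; first by move=> _; split => //; exact: ltW.
    by apply/trivIsetP => i j _ _; rewrite !ord1 eqxx.
  by move/ltr_normlW; lra.
move=> s t s0 st; have [t1|t1] := leP t 1.
  by rewrite !Al ?(le_trans st)//; [exact: dec|exact: lt_le_trans st].
have [s1|s1] := leP s 1; last by rewrite !Ar// ler_pM2l//; apply: dec.
apply: le_trans (A1 _ t1) _; rewrite !Al//; exact: dec.
Qed.

Theorem corollary1p25 (R : realType) (Z : topologicalLmodType R)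
    (X0 X1 : completeNormedModType R)
    (i0 : {linear X0 -> Z}) (i1 : {linear X1 -> Z})
    (hX : compatible_couple i0 i1)
    (a alpha A B : R -> R) (c : R)
    (a_sv : slowly_varying a) (a_ac : locally_abs_continuous a)
    (a_decr : strictly_decreasing a)
    (a_zero : a t @[t --> 0^'+] --> +oo)
    (a_infty : exists2 l : R, 0 < l & a t @[t --> +oo] --> l)
    (alpha_sv : slowly_varying alpha) (alpha_ac : locally_abs_continuous alpha)
    (alpha_decr : strictly_decreasing alpha)
    (alpha_zero : alpha t @[t --> 0^'+] --> +oo)
    (alpha_infty : alpha t @[t --> +oo] --> 0)
    (A_left : forall x : R, 0 < x -> x <= 1 -> A x = a x)
    (A_right : forall x : R, 1 < x -> A x = c * alpha x)
    (c_gt0 : 0 < c)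
    (A_sv : slowly_varying A) (A_ac : locally_abs_continuous A)
    (B_def : {ae lebesgue_measure, forall x : R, 0 < x ->
               B x = - x * derive1 A x}) :
  let E0 := embedded i0 in
  let E1 := embedded i1 in
  same_space (J_space E0 E1 a) (inter_space E0 (J_space E0 E1 A)) /\
  same_space (inter_space E0 (J_space E0 E1 A))
             (inter_space E0 (K_space E0 E1 B)).
Proof.
move=> E0 E1; set JA := J_space E0 E1 A; set Ja := J_space E0 E1 a; set KB := K_space E0 E1 B.
have hE : seminormed E0 by exact: seminormed_embedded.
have hF : seminormed E1 by exact: seminormed_embedded.
have defS := sum_enorm_definite hX.
have compE : seq_complete E0 by apply: seq_complete_embedded; have [_ []] := hX.
have a0 s : 0 < s -> 0 < a s by case: a_sv => + _ _; exact.
have A0 s : 0 < s -> 0 < A s by case: A_sv => + _ _; exact.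
have a00 s : 0 < s -> 0 <= a s by move=> /a0/ltW.
have A00 s : 0 < s -> 0 <= A s by move=> /A0/ltW.
have a_ni s t : 0 < s -> s <= t -> a t <= a s.
  by move=> s0; rewrite le_eqVlt => /predU1P[->//|/(a_decr _ _ s0)/ltW].
have A_ni := glued_nonincreasing a_decr alpha_decr c_gt0 A_left A_right A_ac.
have [h [mh h0 hA' hA]] := derivative_density A_ni A_ac.
have hB : {ae (@lebesgue_measure R), forall x, pos x -> `|x^-1 * B x|%:E = h x}.
  apply: filterS2 hA' B_def => x hx Bx x0; rewrite -hx//.
  move: x0; rewrite in_posE => x0; rewrite Bx// mulrA mulrN mulVf ?gt_eqF// mulN1r.
  by rewrite normrN.
have [l l0 la] := a_infty.
have al s : 0 < s -> l <= a s.
  move=> s0; apply: (cvgr_to_le la); near=> t.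
  apply: a_ni => //; near: t; exact: nbhs_pinfty_ge.
have M0 : 0 < a 1 / l by rewrite divr_gt0// a0.
have AM s : 0 < s -> A s <= a 1 / l * a s.
  move=> s0; have [s1|/ltW s1] := leP s 1.
    rewrite A_left// ler_peMl ?a00// ler_pdivlMr// mul1r al//.
  apply: le_trans (A_ni 1 s ltr01 s1) _; rewrite A_left// -mulrA ler_peMr ?a00//.
  by rewrite mulrC ler_pdivlMr// mul1r al.
have [C C0 AC] := slowly_varying_growth A_sv.
have [C' C'0 aC] := slowly_varying_growth a_sv.
(* a (s / 2) <= a (s / 4) <= 2 C' a s; the summand 1 makes D at least 1 *)
pose D := 1 + 2 * C'.
have D1 : 1 <= D by rewrite /D; lra.
have aD s : 0 < s -> a (s / 2) <= D * a s.
  move=> s0; have := aC s 1%N s0; rewrite !expr1 => H.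
  apply: (@le_trans _ _ (a (s / 4))); first by apply: a_ni; lra.
  by apply: le_trans H _; rewrite /D; have := a0 s s0; nra.
have step1 f (fJ : carrier Ja f) := Jspace_in_left hE hF defS compE l0 al fJ.
have step1' f (fJ : carrier Ja f) := Jspace_le hE hF M0 A00 a00 AM fJ.
have step2 f (fJ : carrier JA f) := Jspace_sub_Kspace hE hF mh h0 hB hA A00 C0 AC fJ.
have step3 f (fE : carrier E0 f) (fK : carrier KB f) :=
  Kspace_sub_Jspace hE hF defS mh h0 hB hA a0 a_ni A_left D1 a_zero aD fE fK.
set c2 := 4 * C + 1 in step2.
set c3 := 8 * (a 1 + 2 * D * a 1 + 4 * D) in step3.
have c2p : 0 < c2 by rewrite /c2; lra.
have c3p : 0 < c3 by rewrite /c3; have := a0 1 ltr01; nra.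
have EJ f : carrier E0 f -> carrier JA f -> carrier Ja f.
  by move=> fE /step2[/(step3 f fE)[]].
have E00 f : (0 <= enorm E0 f)%E by exact: esn_ge0 hE.1 _.
have le_l (G : normed_subspace R Z) f :
    (enorm E0 f <= 1%:E * maxe (enorm E0 f) (enorm G f))%E.
  by rewrite mul1e le_max lexx.
have max0 (G : normed_subspace R Z) f :
    (0 <= maxe (enorm E0 f) (enorm G f))%E.
  by rewrite le_max E00.
have leKA f : carrier JA f -> (maxe (enorm E0 f) (enorm KB f) <=
    (Num.max 1 c2)%:E * maxe (enorm E0 f) (enorm JA f))%E.
  move=> fA; apply: max_le_scale => //; have [_ NK] := step2 f fA.
  apply: (le_trans NK); apply: lee_wpmul2l; first by rewrite lee_fin ltW.
  by rewrite le_max lexx orbT.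
have mx1 (x : R) : 0 < Num.max 1 x by rewrite lt_max ltr01.
split; split.
- apply/seteqP; split => f.
    by move=> fJ; split; [exact: (step1 f fJ).1|exact: (step1' f fJ).1].
  by move=> [fE fJ]; exact: EJ.
- exists (c3 * Num.max 1 c2), (Num.max l^-1 (a 1 / l)).
  split; [exact: mulr_gt0|by rewrite lt_max M0 orbT|] => f fJ.
  have [fE Nl] := step1 f fJ; have [fA NA] := step1' f fJ.
  have [fK _] := step2 f fA; have [_ N3] := step3 f fE fK.
  split; last exact: max_le_scale (Jnorm_ge0 _ _ _ _) Nl NA.
  apply: (le_trans N3); rewrite [(c3 * _)%:E]EFinM -muleA.
  by apply: lee_wpmul2l; [rewrite lee_fin ltW|exact: leKA].
- apply/seteqP; split => f [fE fJ]; split => //; first exact: (step2 f fJ).1.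
  exact: (step1' f (step3 f fE fJ).1).1.
- exists (Num.max 1 (a 1 / l * c3)), (Num.max 1 c2).
  split => // f [fE fA]; split; last exact: leKA.
  have [fK _] := step2 f fA; have [fJ N3] := step3 f fE fK.
  have [_ NA] := step1' f fJ.
  apply: (max_le_scale (max0 KB f) (le_l KB f)).
  rewrite [(a 1 / l * c3)%:E]EFinM -muleA; apply: (le_trans NA).
  by apply: lee_wpmul2l => //; rewrite lee_fin ltW.
Unshelve. all: by end_near.
Qed.
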